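(* Let $(X,\Omega,\mathcal{H})$ be a holomorphic Hamiltonian system. Then, for any $z_0\in\mathbb{C}$ and $x_0\in X$, there exist an open and connected subset $U\subset\mathbb{C}$ with $z_0\in U$ and a holomorphic trajectory $\gamma^{z_0,x_0}:U\to X$ of $(X,\Omega,\mathcal{H})$ with $\gamma^{z_0,x_0}(z_0)=x_0$. Any two holomorphic trajectories $\gamma_1^{z_0,x_0}:U_1\to X$ and $\gamma_2^{z_0,x_0}:U_2\to X$ with $\gamma_1^{z_0,x_0}(z_0)=x_0=\gamma_2^{z_0,x_0}(z_0)$ locally coincide (i.e. agree near $z_0$); in particular, they are equal if and only if their domains $U_1$ and $U_2$ are equal. Furthermore, the holomorphic trajectory $\gamma^{z_0,x_0}$ depends holomorphically on $z_0$ and $x_0$.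
   Context: A holomorphic Hamiltonian system is a triple $(X,\Omega,\mathcal{H})$ where $X$ is a complex manifold, $\Omega$ is a closed holomorphic $2$-form on $X$ that is non-degenerate on $T^{(1,0)}X$, and $\mathcal{H}:X\to\mathbb{C}$ is holomorphic. Its Hamiltonian vector field $X_{\mathcal{H}}$ is the holomorphic vector field (section of $T^{(1,0)}X$) defined by $\iota_{X_{\mathcal{H}}}\Omega=-d\mathcal{H}$. A holomorphic trajectory is a holomorphic map $\gamma:U\to X$, where $U\subset\mathbb{C}$ is open and connected, satisfying $\gamma'(z)=X_{\mathcal{H}}(\gamma(z))$ for all $z\in U$, where $\gamma'$ is the complex derivative of $\gamma$. *)

(* Defs.v *)
From HB Require Import structures.
From mathcomp Require Import all_boot all_order all_algebra.
From mathcomp Require Import complex.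
From mathcomp Require Import all_classical all_reals all_analysis.

Set Implicit Arguments.
Unset Strict Implicit.
Unset Printing Implicit Defensive.

Import Order.TTheory GRing.Theory Num.Theory.
Import numFieldNormedType.Exports.

Local Open Scope classical_set_scope.
Local Open Scope ring_scope.
Local Open Scope complex_scope.

Lemma near_eq_diff (K : numFieldType) (V W : normedModType K)
  (f g : V -> W) (a v : V) :
  differentiable f a -> differentiable g a -> {near a, f =1 g} ->
  'd f a v = 'd g a v.
Proof.
move=> df dg fg; rewrite -(deriveE v df) -(deriveE v dg).
exact: near_eq_derive.
Qed.

Lemma diff_compE (K : numFieldType) (U V W : normedModType K)
  (f : U -> V) (g : V -> W) x y v :
  f x = y -> differentiable f x -> differentiable g y ->
  'd g y ('d f x v) = 'd (g \o f) x v.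
Proof. by move=> <- df dg; rewrite [in RHS]diff_comp. Qed.

(* The field of complex numbers, as a numeric field: the library's topology and
   normed-module structures on numeric fields then apply to it, and
   [differentiable] is complex (Frechet) differentiability. *)
Definition Cplx (R : realType) : numFieldType := R[i].

(* The definitions below only need the scalars to form a numeric field [C]; they
   have their intended meaning for [C := Cplx R], where "differentiable at every
   point of an open set" means holomorphic. *)
Section Manifolds.
Variables (C : numFieldType) (n : nat).

Record chart (X : topologicalType) := Chart {
  cdom : set X;
  ccod : set 'rV[C]_n;
  cmap : X -> 'rV[C]_n;
  cinv : 'rV[C]_n -> X;
  cdom_open : open cdom;
  ccod_open : open ccod;
  cmap_cod : forall x, cdom x -> ccod (cmap x);
  cinv_dom : forall p, ccod p -> cdom (cinv p);
  cmapK : forall x, cdom x -> cinv (cmap x) = x;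
  cinvK : forall p, ccod p -> cmap (cinv p) = p;
  cmap_cont : forall x, cdom x -> {for x, continuous cmap};
  cinv_cont : forall p, ccod p -> {for p, continuous cinv}
}.

Definition transition (X : topologicalType) (c d : chart X) :
  'rV[C]_n -> 'rV[C]_n := cmap d \o cinv c.

(* The differential of a map [f] acts on row vectors by [v *m jacobian f p]. *)
Definition transition_jac (X : topologicalType) (c d : chart X) (x : X) :
  'M[C]_n := jacobian (transition c d) (cmap c x).

Record complex_manifold := ComplexManifold {
  carrier :> topologicalType;
  carrier_hausdorff : hausdorff_space carrier;
  carrier_second_countable : @second_countable carrier;
  atlas : Type;
  chart_of : atlas -> chart carrier;
  atlas_cover : forall x, exists i, cdom (chart_of i) x;
  atlas_holo : forall i j x, cdom (chart_of i) x -> cdom (chart_of j) x ->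
    differentiable (transition (chart_of i) (chart_of j)) (cmap (chart_of i) x)
}.

(* A holomorphic (2,0)-form, given by its component matrices in the charts:
   in the chart [i], at the point of coordinates [p], it sends the tangent
   vectors of T^(1,0) with components [u] and [v] to [form_eval _ i p u v].
   [form_compat] is the pull-back rule under a change of charts. *)
Record holo_two_form (X : complex_manifold) := HoloTwoForm {
  form_mx : atlas X -> 'rV[C]_n -> 'M[C]_n;
  form_holo : forall i p, ccod (chart_of i) p -> differentiable (form_mx i) p;
  form_alt : forall i p, ccod (chart_of i) p -> (form_mx i p)^T = - form_mx i p;
  form_compat : forall i j x,
    cdom (chart_of i) x -> cdom (chart_of j) x ->
    let J := transition_jac (chart_of i) (chart_of j) x in
    form_mx i (cmap (chart_of i) x) =
      J *m form_mx j (cmap (chart_of j) x) *m J^T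
}.

Definition form_eval (X : complex_manifold) (Om : holo_two_form X)
  (i : atlas X) (p u v : 'rV[C]_n) : C := (u *m form_mx Om i p *m v^T) 0 0.

Definition basis_vec (a : 'I_n) : 'rV[C]_n := delta_mx 0 a.

(* The components (d Om)_{abc} vanish. *)
Definition closed_form (X : complex_manifold) (Om : holo_two_form X) : Prop :=
  forall (i : atlas X) (p : 'rV[C]_n), ccod (chart_of i) p ->
  forall a b c : 'I_n,
    'D_(basis_vec a) (fun q => form_mx Om i q b c) p
    + 'D_(basis_vec b) (fun q => form_mx Om i q c a) p
    + 'D_(basis_vec c) (fun q => form_mx Om i q a b) p = 0.

Definition nondegenerate_form (X : complex_manifold) (Om : holo_two_form X) :
  Prop :=
  forall (i : atlas X) (p : 'rV[C]_n), ccod (chart_of i) p ->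
  forall u : 'rV[C]_n, (forall v, form_eval Om i p u v = 0) -> u = 0.

Definition holo_fun (X : complex_manifold) (H : X -> C) : Prop :=
  forall (i : atlas X) (p : 'rV[C]_n), ccod (chart_of i) p ->
    differentiable (H \o cinv (chart_of i)) p.

Record hol_ham_system := HolHamSystem {
  ham_space :> complex_manifold;
  ham_form : holo_two_form ham_space;
  ham_form_closed : closed_form ham_form;
  ham_form_nondeg : nondegenerate_form ham_form;
  ham_fun : ham_space -> C;
  ham_fun_holo : holo_fun ham_fun
}.

(* A section of T^(1,0)X, given by its components in the charts. *)
Record vector_field (X : complex_manifold) := VectorField {
  vf_comp : atlas X -> 'rV[C]_n -> 'rV[C]_n;
  vf_compat : forall i j x,
    cdom (chart_of i) x -> cdom (chart_of j) x ->
    vf_comp j (cmap (chart_of j) x) =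
      vf_comp i (cmap (chart_of i) x)
        *m transition_jac (chart_of i) (chart_of j) x
}.

(* [u] represents at [p] the vector whose contraction with Om is - dH. *)
Definition ham_vec (S : hol_ham_system) (i : atlas S) (p u : 'rV[C]_n) : Prop :=
  forall v : 'rV[C]_n, form_eval (ham_form S) i p u v =
    - 'd (ham_fun (h:=S) \o cinv (chart_of i)) p v.

Lemma pullback_mx (A B M : 'M[C]_n) (u v : 'rV[C]_n) : A *m B = 1%:M ->
  u *m A *m (B *m M *m B^T) *m v^T = u *m M *m (v *m B)^T.
Proof.
by move=> AB; rewrite trmx_mul !mulmxA -(mulmxA u A) AB mulmx1.
Qed.

Section HamiltonianVectorField.
Variable S : hol_ham_system.

Lemma form_unit (i : atlas S) p : ccod (chart_of i) p ->
  form_mx (ham_form S) i p \in unitmx.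
Proof.
move=> ip; rewrite -row_free_unit -kermx_eq0.
apply/eqP/row_matrixP => k; rewrite row0.
apply: (ham_form_nondeg (h:=S) ip) => v.
have /sub_kermxP kE := row_sub k (kermx (form_mx (ham_form S) i p)).
by rewrite /form_eval kE mul0mx mxE.
Qed.

Lemma ham_vec_inj (i : atlas S) p u v : ccod (chart_of i) p ->
  ham_vec i p u -> ham_vec i p v -> u = v.
Proof.
move=> ip uH vH; apply/eqP; rewrite -subr_eq0; apply/eqP.
apply: (ham_form_nondeg (h:=S) ip) => w.
move: (uH w) (vH w); rewrite /form_eval !mulmxBl !mxE => -> ->.
by rewrite subrr.
Qed.

Lemma ham_vec_exists (i : atlas S) p : ccod (chart_of i) p ->
  exists u, ham_vec i p u.
Proof.
move=> ip.
pose dH := 'd (ham_fun (h:=S) \o cinv (chart_of i)) p.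
exists ((\row_a - dH (basis_vec a)) *m invmx (form_mx (ham_form S) i p)) => v.
rewrite /form_eval mulmxKV ?form_unit// -/dH mxE.
rewrite [in RHS](row_sum_delta v) linear_sum -sumrN; apply: eq_bigr => a _.
by rewrite !mxE linearZ /= mulNr mulrC.
Qed.

Definition ham_comp (i : atlas S) (p : 'rV[C]_n) : 'rV[C]_n :=
  get (ham_vec i p).

Lemma ham_compP (i : atlas S) p : ccod (chart_of i) p ->
  ham_vec i p (ham_comp i p).
Proof. by move=> /ham_vec_exists[u uP]; exact: (getI uP). Qed.

Lemma near_chart (i j : atlas S) x :
  cdom (chart_of i) x -> cdom (chart_of j) x ->
  \forall q \near cmap (chart_of i) x,
    ccod (chart_of i) q /\ cdom (chart_of j) (cinv (chart_of i) q).
Proof.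
move=> ix jx; have iq := cmap_cod ix.
near=> q; split; near: q.
  by apply: open_nbhs_nbhs; split=> //; exact: ccod_open.
apply: (cinv_cont iq); apply: open_nbhs_nbhs.
by split; [exact: cdom_open | rewrite cmapK].
Unshelve. all: by end_near. Qed.

Lemma transitionE (i j : atlas S) x : cdom (chart_of i) x ->
  transition (chart_of i) (chart_of j) (cmap (chart_of i) x)
  = cmap (chart_of j) x.
Proof. by move=> ix; rewrite /transition /= cmapK. Qed.

Lemma transition_diffE (i j : atlas S) x v :
  'd (transition (chart_of i) (chart_of j)) (cmap (chart_of i) x) v
  = v *m transition_jac (chart_of i) (chart_of j) x.
Proof. by rewrite /transition_jac /jacobian mul_rV_lin1. Qed.

Lemma transition_jacK (i j : atlas S) x :
  cdom (chart_of i) x -> cdom (chart_of j) x ->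
  transition_jac (chart_of i) (chart_of j) x
    *m transition_jac (chart_of j) (chart_of i) x = 1%:M.
Proof.
move=> ix jx; apply/row_matrixP => k; rewrite !rowE mulmxA mulmx1.
have dij := atlas_holo ix jx; have dji := atlas_holo jx ix.
rewrite -!transition_diffE (diff_compE _ (transitionE j ix) dij dji).
rewrite (@near_eq_diff _ _ _ _ id)//.
- by rewrite diff_val.
- by apply: differentiable_comp; rewrite ?transitionE.
- apply: filterS (near_chart ix jx) => q [iq jq].
  by rewrite /transition /= cmapK// cinvK.
Qed.

Lemma ham_comp_compat (i j : atlas S) x :
  cdom (chart_of i) x -> cdom (chart_of j) x ->
  ham_comp j (cmap (chart_of j) x) =
    ham_comp i (cmap (chart_of i) x)
      *m transition_jac (chart_of i) (chart_of j) x.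
Proof.
move=> ix jx; have jq := cmap_cod jx; have ip := cmap_cod ix.
apply: (ham_vec_inj jq (ham_compP jq)) => v.
rewrite /form_eval (form_compat (ham_form S) jx ix).
rewrite (pullback_mx _ _ _ (transition_jacK ix jx)).
rewrite [LHS](ham_compP ip); congr (- _).
have dji := atlas_holo jx ix.
have dH := @ham_fun_holo S i _ ip.
rewrite -(transition_diffE j i x v).
apply: etrans (diff_compE v (transitionE i jx) dji dH) _.
apply: near_eq_diff.
- by apply: differentiable_comp; rewrite ?transitionE.
- exact: ham_fun_holo.
- apply: filterS (near_chart jx ix) => q [jq' iq].
  by rewrite /transition /= cmapK.
Qed.

(* X_H: the vector field whose value is, at each point, the unique [u] with
   Om(u, .) = - dH (see [ham_compP] and [ham_vec_inj]). *)
Definition ham_vf : vector_field S := VectorField ham_comp_compat.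

End HamiltonianVectorField.

(* Used only with [A] open, in a normed module [V] over C. *)
Definition holomorphic_on (X : complex_manifold) (V : normedModType C)
  (A : set V) (f : V -> X) : Prop :=
  forall v, A v -> {for v, continuous f} /\
    forall i : atlas X, cdom (chart_of i) (f v) ->
      differentiable (cmap (chart_of i) \o f) v.

(* A holomorphic trajectory [gamma : U -> X]; the values of [gamma] outside [U]
   are irrelevant. The last clause is gamma'(z) = X_H(gamma(z)) in charts. *)
Definition trajectory (S : hol_ham_system) (U : set C) (gamma : C -> S) :
  Prop :=
  [/\ open U, connected U, holomorphic_on U gamma &
      forall z, U z -> forall i : atlas S, cdom (chart_of i) (gamma z) ->
        derive1 (cmap (chart_of i) \o gamma) z =
          vf_comp (ham_vf S) i (cmap (chart_of i) (gamma z))].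

(* Equality of [gamma1 : U1 -> X] and [gamma2 : U2 -> X] as maps. *)
Definition same_map (X : complex_manifold) (U1 : set C) (gamma1 : C -> X)
  (U2 : set C) (gamma2 : C -> X) : Prop :=
  U1 = U2 /\ forall z, U1 z -> gamma1 z = gamma2 z.

(* Joint holomorphy of (z, z1, x1) |-> Gamma z1 x1 z on the product D x V x W
   of open subsets of C, C and X, read in the product charts. *)
Definition holomorphic_family (X : complex_manifold) (D V : set C) (W : set X)
  (Gamma : C -> X -> C -> X) : Prop :=
  forall i : atlas X,
    @holomorphic_on X (C * C * 'rV[C]_n)%type
      [set q | [/\ D q.1.1, V q.1.2, ccod (chart_of i) q.2 &
                   W (cinv (chart_of i) q.2)]]
      (fun q => Gamma q.1.2 (cinv (chart_of i) q.2) q.1.1).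

End Manifolds.

(* Main.v *)
From HB Require Import structures.
Require Import Defs.
From mathcomp Require Import all_boot all_order all_algebra.
From mathcomp Require Import complex ring lra.
From mathcomp Require Import all_classical all_reals all_analysis.

Set Implicit Arguments.
Unset Strict Implicit.
Unset Printing Implicit Defensive.

Import Order.TTheory GRing.Theory Num.Theory.
Import numFieldNormedType.Exports.

Local Open Scope classical_set_scope.
Local Open Scope ring_scope.
Local Open Scope complex_scope.

(* In a chart the Hamiltonian field is [- dH Om^-1], so the point is that the
   derivative of a holomorphic function is holomorphic, and that a holomorphic
   field has a jointly holomorphic local flow.

   Integrals are avoided. For [g] holomorphic, the left Riemann sums of [g dw]
   along the boundary of a rectangle are additive under bisection and vanish
   exactly for affine [g]; Goursat's bisection argument then shows that they tend
   to 0. Applied to [g w = f (e^w) / e^w] on [a, b] x [0, 2 pi] this gives [f' 0]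
   as the limit of the averages of [f z / z] over the [2^m]-th roots of unity
   times [r]. Cauchy's estimates, a quadratic Taylor bound, and the holomorphy of
   pointwise limits of bounded holomorphic maps follow in any dimension.

   The flow is the limit of Euler's polygons with [2^m] steps. They are
   holomorphic in time and initial point as compositions of holomorphic maps, so
   the limit is as well, and their time derivatives converge. Uniqueness comes
   from the mean value inequality locally, and from connectedness and the
   Hausdorff property globally. *)

(** * A real-valued norm *)

(** Complex differentiability asserts no continuity of the derivative, and Goursat's argument gets
    by with differentiability at one point at a time. Dyadic sums make sense in any normed module
    and, being finite, inherit holomorphy in a parameter from their terms; so the averages over
    circles are themselves holomorphic approximations of a derivative, to which the theorem on
    limits applies. They represent [f' 0] rather than [f 0] because the estimates start from a bound
    on the derivative: used twice, it bounds increments of the derivative and so replaces a second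
    derivative.

    The theorem on limits asks only for pointwise convergence and a uniform bound. For Euler's
    polygons it therefore suffices to confine them to a ball and to compare [2 ^ m] steps with
    [2 ^ m.+1] steps. Time is complex: a polygon takes [2 ^ m] steps of complex size [t / 2 ^ m],
    which makes it a map of [t] and the starting point together. Its derivative in [t] is not the
    field at its endpoint; that the gap is of order [2 ^ - m] is a separate estimate, and it is what
    makes the limit a solution. *)

Section RealNorm.
Context {R : realType}.
Local Notation C := (Cplx R).

Definition cR (x : R) : C := x%:C.

(** The norm of a module over [Cplx R] takes values in [R[i]], which is only partially ordered.
    Taking the real part loses nothing ([normE]) and puts the estimates in a real field, where [lra]
    and [nra] decide them. *)
Definition rn (V : normedModType C) (v : V) : R := complex.Re (`|v| : R[i]).

Lemma cRD x y : cR (x + y) = cR x + cR y.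
Proof. exact: (rmorphD (real_complex R)). Qed.
Lemma cRB x y : cR (x - y) = cR x - cR y.
Proof. exact: (rmorphB (real_complex R)). Qed.
Lemma cRM x y : cR (x * y) = cR x * cR y.
Proof. exact: (rmorphM (real_complex R)). Qed.

Lemma cR0 : cR 0 = 0. Proof. by []. Qed.
Lemma cR1 : cR 1 = 1. Proof. by []. Qed.
Lemma cRV x : cR x^-1 = (cR x)^-1.
Proof. exact: (fmorphV (real_complex R)). Qed.
Lemma cR_le x y : (cR x <= cR y) = (x <= y).
Proof. exact: lecR. Qed.
Lemma cR_lt x y : (cR x < cR y) = (x < y).
Proof. exact: ltcR. Qed.
Lemma cR_eq0 x : (cR x == 0) = (x == 0).
Proof. exact: (fmorph_eq0 (real_complex R)). Qed.

Section V.
Context {V : normedModType C}.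
Implicit Types u v w : V.

Lemma normE v : `|v| = cR (rn v).
Proof. by rewrite /cR /rn RRe_real// normr_real. Qed.

Lemma rn_ge0 v : 0 <= rn v.
Proof. by rewrite -cR_le -normE cR0 normr_ge0. Qed.

Lemma rn0 : rn (0 : V) = 0. Proof. by rewrite /rn normr0. Qed.

Lemma rn_eq0 v : (rn v == 0) = (v == 0).
Proof. by rewrite -cR_eq0 -normE normr_eq0. Qed.

Lemma rn_gt0 v : (0 < rn v) = (v != 0).
Proof. by rewrite lt0r rn_eq0 rn_ge0 andbT. Qed.

Lemma rnN v : rn (- v) = rn v. Proof. by rewrite /rn normrN. Qed.

Lemma rnD u v : rn (u + v) <= rn u + rn v.
Proof. by rewrite -cR_le cRD -!normE ler_normD. Qed.

Lemma rnB u v : rn (u - v) <= rn u + rn v.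
Proof. by rewrite -(rnN v) rnD. Qed.

Lemma rnC u v : rn (u - v) = rn (v - u). Proof. by rewrite -rnN opprB. Qed.

Lemma rn_tri w u v : rn (u - v) <= rn (u - w) + rn (w - v).
Proof. by apply: le_trans (rnD _ _); rewrite addrA subrK. Qed.

End V.

Lemma rnZ (V : normedModType C) (a : C) (v : V) : rn (a *: v) = rn a * rn v.
Proof. by apply: (@complexI R); rewrite -/(cR _) -normE normrZ !normE -cRM. Qed.

Lemma rnM (a b : C) : rn (a * b) = rn a * rn b.
Proof. by apply: (@complexI R); rewrite -/(cR _) -normE normrM !normE -cRM. Qed.

Lemma rnV (a : C) : rn a^-1 = (rn a)^-1.
Proof. by apply: (@complexI R); rewrite -/(cR _) -normE normfV !normE -cRV. Qed.

Lemma rn_cR (x : R) : rn (cR x) = `|x|.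
Proof.
apply: (@complexI R); rewrite -/(cR _) -normE /cR /=.
by rewrite normc_def /= expr0n addr0 sqrtr_sqr.
Qed.

Lemma rn_complex (x y : R) : rn ((x +i* y) : C) = Num.sqrt (x ^+ 2 + y ^+ 2).
Proof. by rewrite /rn normc_def. Qed.

Lemma posC (e : C) : 0 < e -> exists2 d : R, 0 < d & e = cR d.
Proof.
move=> e0; exists (complex.Re e); last by rewrite /cR RRe_real// gtr0_real.
by rewrite -cR_lt /cR (RRe_real (gtr0_real e0)).
Qed.

Lemma rn_nearP (V : normedModType C) (p : V) (P : set V) :
  (\forall q \near p, P q) <-> exists2 d : R, 0 < d & forall q, rn (q - p) < d -> P q.
Proof.
split.
  move/nbhs_ballP => [e /= /posC[d d0 ->] H]; exists d => // q qp; apply: H.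
  by rewrite -ball_normE /ball_ /= normE cR_lt rnC.
move=> [d d0 H]; apply/nbhs_ballP; exists (cR d); first by rewrite /= -cR0 cR_lt.
move=> q; rewrite -ball_normE /ball_ /= normE cR_lt rnC; exact: H.
Qed.

Lemma rn_openP (V : normedModType C) (A : set V) :
  open A <-> forall p, A p -> exists2 d : R, 0 < d & forall q, rn (q - p) < d -> A q.
Proof.
rewrite openE; split => H p Ap; first by apply/rn_nearP; exact: H.
by apply/rn_nearP; exact: H.
Qed.

Lemma rn_contP (V W : normedModType C) (f : V -> W) p : {for p, continuous f} <->
  forall e : R, 0 < e -> exists2 d : R, 0 < d & forall q, rn (q - p) < d -> rn (f q - f p) < e.
Proof.
split.
  move=> fp e e0; apply/(rn_nearP p (fun q => rn (f q - f p) < e)).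
  have /fp : nbhs (f p) [set y | rn (y - f p) < e] by apply/rn_nearP; exists e.
  by [].
move=> H A /rn_nearP[e e0 eA]; have [d d0 dA] := H _ e0.
by apply/rn_nearP; exists d => // q /dA; exact: eA.
Qed.

Lemma rn_diff (V W : normedModType C) (f : V -> W) p : differentiable f p ->
  forall e : R, 0 < e -> exists2 d : R, 0 < d & forall v, rn v < d ->
    rn (f (p + v) - f p - 'd f p v) <= e * rn v.
Proof.
move=> /diff_locally /eqaddoP H e e0.
have /H : 0 < cR e by rewrite -cR0 cR_lt.
move=> /rn_nearP[d d0 Hd]; exists d => // v vd.
have := Hd v; rewrite subr0 => /(_ vd) /=.
rewrite !normE -cRM cR_le /cst /= fctE.
by rewrite /shift /= [v + p]addrC opprD addrA.
Qed.

Lemma rn_diff_intro (V W : normedModType C) (f L : V -> W) p (K : R) :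
  linear L -> (forall v, rn (L v) <= K * rn v) ->
  (forall e : R, 0 < e -> exists2 d : R, 0 < d & forall v, rn v < d ->
    rn (f (p + v) - f p - L v) <= e * rn v) ->
  is_diff p f L.
Proof.
move=> linL LK H.
pose LL : {linear V -> W} := HB.pack L (GRing.isLinear.Build _ _ _ _ L linL).
have LLc : continuous LL.
  move=> v; apply/rn_contP => e e0.
  have K1 : 0 < `|K| + 1 by rewrite ltr_wpDl.
  exists (e / (`|K| + 1)); first by rewrite divr_gt0.
  move=> q; rewrite ltr_pdivlMr// => qv; rewrite -linearB/=.
  apply: le_lt_trans (LK _) _; apply: le_lt_trans qv.
  rewrite mulrC ler_wpM2l ?rn_ge0//.
  by rewrite (le_trans (ler_norm _))// lerDl.
have E : f \o shift p = cst (f p) + LL +o_ 0 id.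
  apply/eqaddoP => e' /posC[e e0 ->{e'}].
  have [d d0 Hd] := H _ e0.
  apply/rn_nearP; exists d => // v; rewrite subr0 => /Hd.
  rewrite !normE -cRM cR_le /cst /= fctE.
  by rewrite /shift /= [v + p]addrC opprD addrA.
have dL : 'd f p = LL :> (V -> W) := diff_unique LLc E.
split => //; apply/diff_locallyP; rewrite dL; split => //.
Qed.

End RealNorm.

(** * Identities in abelian groups *)

Section AbelianGroup.

(** Reflection for identities between vectors: an expression is determined by the integer
    coefficients of its atoms, so an equation reduces to a boolean computation. Scalar multiples
    count as atoms. *)
Inductive zexp := ZVar of nat | ZAdd of zexp & zexp | ZOpp of zexp | ZZero.

Fixpoint zeval (V : zmodType) (env : seq V) (e : zexp) : V :=
  match e with
  | ZVar k => env`_k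
  | ZAdd a b => zeval env a + zeval env b
  | ZOpp a => - zeval env a
  | ZZero => 0
  end.

Fixpoint zcoef (e : zexp) (k : nat) : int :=
  match e with
  | ZVar j => (j == k)%:R
  | ZAdd a b => zcoef a k + zcoef b k
  | ZOpp a => - zcoef a k
  | ZZero => 0
  end.

Lemma zevalE (V : zmodType) (env : seq V) e :
  zeval env e = \sum_(k < size env) env`_k *~ zcoef e k.
Proof.
elim: e => [j|a IHa b IHb|a IHa|] /=.
- have [js|js] := ltnP j (size env).
    rewrite (bigD1 (Ordinal js)) //= eqxx big1 ?addr0// => i /negPf.
    by rewrite -val_eqE /= eq_sym => ->.
  rewrite nth_default// big1// => i _.
  by rewrite gtn_eqF// (leq_trans (ltn_ord i)).
- by rewrite IHa IHb -big_split; apply: eq_bigr => k _; rewrite mulrzDr.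
- by rewrite IHa -sumrN; apply: eq_bigr => k _; rewrite mulrNz.
- by rewrite big1// => k _; rewrite mulr0z.
Qed.

Lemma zeval_eq (V : zmodType) (env : seq V) e1 e2 :
  all (fun k => zcoef e1 k == zcoef e2 k) (iota 0 (size env)) ->
  zeval env e1 = zeval env e2.
Proof.
move=> /allP H; rewrite !zevalE; apply: eq_bigr => k _; congr (_ *~ _).
by apply/eqP; apply: H; rewrite mem_iota add0n ltn_ord.
Qed.

End AbelianGroup.

(* Atoms are compared syntactically by [zsame_eq] and, failing that, up to
   conversion by [zsame_conv], since canonical structures may be inferred along
   different paths; [diff] is kept opaque because unfolding it is costly. *)
Ltac zsame_eq x y := constr_eq x y.
Ltac zsame_conv x y := with_strategy opaque [diff] (unify x y).

Ltac zatom same x l :=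
  match l with
  | nil => constr:(x :: nil)
  | ?y :: _ => let _ := match goal with _ => same x y end in l
  | ?y :: ?t => let t' := zatom same x t in constr:(y :: t')
  end.

Ltac zatoms same e l :=
  lazymatch e with
  | @GRing.add _ ?a ?b => let l' := zatoms same a l in zatoms same b l'
  | @GRing.opp _ ?a => zatoms same a l
  | @GRing.zero _ => l
  | _ => zatom same e l
  end.

Ltac zindex same x l :=
  match l with
  | ?y :: _ => let _ := match goal with _ => same x y end in constr:(0%N)
  | _ :: ?t => let k := zindex same x t in constr:(S k)
  end.

Ltac zreify same e l :=
  lazymatch e with
  | @GRing.add _ ?a ?b =>
      let a' := zreify same a l in let b' := zreify same b l in constr:(ZAdd a' b')
  | @GRing.opp _ ?a => let a' := zreify same a l in constr:(ZOpp a')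
  | @GRing.zero _ => constr:(ZZero)
  | _ => let k := zindex same e l in constr:(ZVar k)
  end.

Ltac abelian_with same :=
  lazymatch goal with
  | |- @eq ?T ?x ?y =>
    let l := zatoms same x (@nil T) in let l := zatoms same y l in
    let a := zreify same x l in let b := zreify same y l in
    refine (@zeval_eq _ l a b _); vm_compute; reflexivity
  end.

Ltac abelian := first [abelian_with zsame_eq | abelian_with zsame_conv].

(** * Bisection *)

Section Bisection.
Context {R : realType}.

Lemma half_expr_small (e : R) : 0 < e ->
  exists N, forall n, (N <= n)%N -> 2^-1 ^+ n < e.
Proof.
move=> e0; have /cvgrPdist_lt/(_ e e0)[N _ NH] : (2^-1 ^+ n : R) @[n --> \oo] --> 0.
  by apply: cvg_expr; rewrite ger0_norm; lra.
by exists N => n /NH; rewrite sub0r normrN ger0_norm// exprn_ge0 ?invr_ge0.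
Qed.

Lemma nested_intervals (u : nat -> R) :
  (forall n, u n <= u n.+1 <= u n + 2^-1 ^+ n.+1) ->
  exists x, forall n, u n <= x <= u n + 2^-1 ^+ n.
Proof.
move=> uH.
have le_u n k : u n <= u (n + k)%N /\ u (n + k)%N + 2^-1 ^+ (n + k) <= u n + 2^-1 ^+ n.
  elim: k => [|k [IH1 IH2]]; first by rewrite addn0.
  rewrite addnS; have /andP[h1 h2] := uH (n + k)%N; split; first lra.
  have E : 2^-1 ^+ (n + k) = 2^-1 ^+ (n + k).+1 + 2^-1 ^+ (n + k).+1 :> R.
    by rewrite exprS; lra.
  lra.
have pos k : 0 <= 2^-1 ^+ k :> R by apply: exprn_ge0; lra.
have ub n m : u m <= u n + 2^-1 ^+ n.
  have [nm|/ltnW mn] := leqP n m.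
    have [_] := le_u n (m - n)%N; rewrite subnKC//; have := pos m; lra.
  have [] := le_u m (n - m)%N; rewrite subnKC//; have := pos n; lra.
exists (sup (range u)) => n; apply/andP; split.
  apply: ub_le_sup; last by exists n.
  by exists (u 0%N + 2^-1 ^+ 0) => _ [m _ <-].
apply: ge_sup; first by exists (u 0%N), 0%N.
by move=> _ [m _ <-].
Qed.

(** [P x y h] speaks of the square of side [h] with lower left corner [(x, y)]. If it failed on the
    unit square it would fail on a quarter, and so on; the failing squares shrink to a point, where
    the local hypothesis contradicts the failure on a small enough one. *)
Lemma bisection2 (P : R -> R -> R -> Prop) :
  (forall x y h, 0 < h -> P x y (h / 2) -> P (x + h / 2) y (h / 2) ->
    P x (y + h / 2) (h / 2) -> P (x + h / 2) (y + h / 2) (h / 2) -> P x y h) ->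
  (forall x y, 0 <= x <= 1 -> 0 <= y <= 1 -> exists2 d, 0 < d &
    forall x' y' h, 0 < h < d -> 0 <= x' -> x' <= x <= x' + h -> x' + h <= 1 ->
      0 <= y' -> y' <= y <= y' + h -> y' + h <= 1 -> P x' y' h) ->
  P 0 0 1.
Proof.
move=> split_ local; apply: contrapT => nP.
pose Q n (q : R * R) := ~ P q.1 q.2 (2^-1 ^+ n).
have pos k : 0 < 2^-1 ^+ k :> R by apply: exprn_gt0; lra.
have half n : 2^-1 ^+ n / 2 = 2^-1 ^+ n.+1 :> R by rewrite exprS mulrC.
have dbl n : 2^-1 ^+ n = 2^-1 ^+ n.+1 + 2^-1 ^+ n.+1 :> R by rewrite -half -splitr.
have step (nq : nat * (R * R)) : exists q' : R * R, Q nq.1 nq.2 ->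
    [/\ Q nq.1.+1 q', nq.2.1 <= q'.1 <= nq.2.1 + 2^-1 ^+ nq.1.+1 &
        nq.2.2 <= q'.2 <= nq.2.2 + 2^-1 ^+ nq.1.+1].
  (* The choice function has to be total: where the square is not a failing one, [(0, 0)] is a dummy
     value. *)
  case: nq => n [x y] /=; have [PQ|NQ] := pselect (Q n (x, y)); last by exists (0, 0).
  apply: contrapT => /forallNP H; apply: PQ => /=.
  have h1 := pos n.+1; apply: split_ => //; rewrite half; apply: contrapT => NP.
  - by apply: (H (x, y)) => _; split => //=; lra.
  - by apply: (H (x + 2^-1 ^+ n.+1, y)) => _; split => //=; lra.
  - by apply: (H (x, y + 2^-1 ^+ n.+1)) => _; split => //=; lra.
  - by apply: (H (x + 2^-1 ^+ n.+1, y + 2^-1 ^+ n.+1)) => _; split => //=; lra.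
have [F FP] := choice step.
pose s := fix s n : R * R := if n is m.+1 then F (m, s m) else (0, 0).
have sQ n : Q n (s n).
  by elim: n => [|n IH]; [rewrite /Q /= expr0|have [] := FP (n, s n) IH].
have sx n : (s n).1 <= (s n.+1).1 <= (s n).1 + 2^-1 ^+ n.+1 by have [] := FP (n, s n) (sQ n).
have sy n : (s n).2 <= (s n.+1).2 <= (s n).2 + 2^-1 ^+ n.+1 by have [] := FP (n, s n) (sQ n).
have box n : [/\ 0 <= (s n).1, (s n).1 + 2^-1 ^+ n <= 1, 0 <= (s n).2 & (s n).2 + 2^-1 ^+ n <= 1].
  elim: n => [|n [a b c d]]; first by rewrite /= expr0; split; lra.
  by have := sx n; have := sy n; have := dbl n; split; lra.
have [x xs] := nested_intervals sx; have [y ys] := nested_intervals sy.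
have x01 : 0 <= x <= 1 by have := xs 0%N; rewrite /= expr0; lra.
have y01 : 0 <= y <= 1 by have := ys 0%N; rewrite /= expr0; lra.
have [d d0 dP] := local x y x01 y01.
have [n /(_ n (leqnn n)) nd] := half_expr_small d0.
apply: (sQ n); have [a b c e] := box n.
by apply: dP; rewrite ?pos ?nd ?xs ?ys.
Qed.

Lemma bisection (P : R -> R -> Prop) :
  (forall x h, 0 < h -> P x (h / 2) -> P (x + h / 2) (h / 2) -> P x h) ->
  (forall x, 0 <= x <= 1 -> exists2 d, 0 < d &
    forall x' h, 0 < h < d -> 0 <= x' -> x' <= x <= x' + h -> x' + h <= 1 -> P x' h) ->
  P 0 1.
Proof.
move=> split_ local; apply: (@bisection2 (fun x _ h => P x h)) => [x _ h h0 ? ? _ _|x y x01 _].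
  exact: split_.
by have [d d0 H] := local x x01; exists d => // *; exact: H.
Qed.

End Bisection.

(** * Goursat's theorem with dyadic Riemann sums *)

Section DyadicMean.
Context {R : realType}.
Local Notation C := (Cplx R).

(* The average of [phi] over the [2 ^ m] left endpoints of the dyadic
   subdivision of [[x, x + h]], arranged so that halving the interval is a
   conversion. *)
Fixpoint mean (W : normedModType C) (m : nat) (phi : R -> W) (x h : R) : W :=
  if m is k.+1
  then cR 2^-1 *: (mean k phi x (h / 2) + mean k phi (x + h / 2) (h / 2))
  else phi x.

Section Mean.
Context {W : normedModType C}.
Implicit Types phi psi : R -> W.

Lemma half_scale_le (u v : W) (K : R) : rn u <= K -> rn v <= K ->
  rn (cR 2^-1 *: (u + v)) <= K.
Proof.
move=> uK vK; rewrite rnZ rn_cR ger0_norm ?invr_ge0//.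
by have := rnD u v; lra.
Qed.

Lemma half_scaleDD (u : W) : cR 2^-1 *: (u + u) = u.
Proof.
have E : 2^-1 + 2^-1 = 1 :> R by lra.
by rewrite scalerDr -scalerDl -cRD E scale1r.
Qed.

Lemma mean_le phi (K : R) m x h : 0 <= h ->
  (forall t, x <= t <= x + h -> rn (phi t) <= K) -> rn (mean m phi x h) <= K.
Proof.
elim: m x h => [|m IH] x h h0 H /=; first by apply: H; lra.
by apply: half_scale_le; apply: IH => [|t tx]; try apply: H; lra.
Qed.

Lemma eq_mean phi psi m x h : 0 <= h ->
  (forall t, x <= t <= x + h -> phi t = psi t) -> mean m phi x h = mean m psi x h.
Proof.
elim: m x h => [|m IH] x h h0 H /=; first by apply: H; lra.
by congr (_ *: (_ + _)); apply: IH => [|t tx]; try apply: H; lra.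
Qed.

Lemma meanB phi psi m x h :
  mean m (fun t => phi t - psi t) x h = mean m phi x h - mean m psi x h.
Proof.
elim: m x h => [|m IH] x h //=.
by rewrite !IH -scalerBr opprD addrACA.
Qed.

Lemma mean_cst (w : W) m x h : mean m (fun=> w) x h = w.
Proof. by elim: m x h => [|m IH] x h //=; rewrite !IH half_scaleDD. Qed.

Lemma mean_scale (a : R -> C) (w : W) m x h :
  mean m (fun t => a t *: w) x h = mean m (a : R -> C^o) x h *: w.
Proof.
by elim: m x h => [|m IH] x h //=; rewrite !IH -scalerDl scalerA.
Qed.

Lemma mean_shift phi m x y h : mean m (fun t => phi (t + y)) x h = mean m phi (x + y) h.
Proof.
by elim: m x h => [|m IH] x h //=; rewrite !IH addrAC.
Qed.

End Mean.

Section Goursat.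
Context {W : normedModType C}.
Variables (G : R -> R -> W) (A B : R).
Hypotheses (A0 : 0 < A) (B0 : 0 < B).
Hypothesis G_diff : forall x y : R, 0 <= x <= 1 -> 0 <= y <= 1 -> exists b : W,
  forall e : R, 0 < e -> exists2 d : R, 0 < d & forall x' y' : R,
    `|x' - x| < d -> `|y' - y| < d ->
    rn (G x' y' - G x y - ((A * (x' - x)) +i* (B * (y' - y)) : C) *: b)
      <= e * (`|x' - x| + `|y' - y|).

Let iB (h : R) : C := 0 +i* (B * h).

(* The Riemann sum of the integral of [G dw] along the boundary of the square of
   side [h] at [(x, y)], where [dw = A dx + i B dy]. *)
Let bdry m (x y h : R) : W :=
  iB h *: (mean m (G (x + h)) y h - mean m (G x) y h)
  - cR (A * h) *: (mean m (G ^~ (y + h)) x h - mean m (G ^~ y) x h).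

(** An inner edge is shared by two quarters with opposite orientations and cancels. The identity is
    exact because [mean m.+1] is by definition the average of two [mean m], and the factor [1 / 2]
    turns [h] into the side of a quarter. *)
Let bdry_split m x y h : bdry m.+1 x y h =
  (bdry m x y (h / 2) + bdry m (x + h / 2) y (h / 2)) +
  (bdry m x (y + h / 2) (h / 2) + bdry m (x + h / 2) (y + h / 2) (h / 2)).
Proof.
have p2 : iB h * cR 2^-1 = iB (h / 2).
  apply/eqP; rewrite eq_complex /=; apply/andP; split; apply/eqP; lra.
have q2 : cR (A * h) * cR 2^-1 = cR (A * (h / 2)) by rewrite -cRM mulrA.
rewrite /bdry /= -!scalerBr !scalerA p2 q2 -(addrA x) -(addrA y) -!splitr.
move: (iB _) (cR _) => p q.
rewrite [X in _ = X + _]addrACA [X in _ = _ + X]addrACA -!opprD.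
rewrite [RHS]addrACA -!opprD -!scalerDr.
congr (_ *: _ - _ *: _).
  by rewrite [X in _ = X + _]addrC [X in _ = _ + X]addrC !subrKA opprD addrACA.
rewrite [RHS]addrACA.
by rewrite [X in _ = X + _]addrC [X in _ = _ + X]addrC !subrKA opprD addrACA.
Qed.

(** With [b] the slope of an affine approximation, the increments across the square are close to
    [A h b] and [i B h b]. Each is multiplied by the other side, which gives [i A B h ^+ 2 b] twice
    with opposite signs; only the errors [e] are left. *)
Let bdry_le m (x y h : R) (b : W) (e : R) : 0 <= h ->
  (forall x' y' : R, x <= x' <= x + h -> y <= y' <= y + h ->
     rn (G (x + h) y' - G x y' - cR (A * h) *: b) <= e /\
     rn (G x' (y + h) - G x' y - iB h *: b) <= e) ->
  rn (bdry m x y h) <= (A + B) * h * e.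
Proof.
move=> h0 H; rewrite /bdry -!meanB.
have xx : x <= x <= x + h by lra.
have yy : y <= y <= y + h by lra.
pose V := mean m (fun t => G (x + h) t - G x t - cR (A * h) *: b) y h.
pose U := mean m (fun t => G t (y + h) - G t y - iB h *: b) x h.
have VE : rn V <= e by apply: mean_le => // t ty; case: (H x t xx ty).
have UE : rn U <= e by apply: mean_le => // t tx; case: (H t y tx yy).
have -> : mean m (fun t => G (x + h) t - G x t) y h = V + cR (A * h) *: b.
  by rewrite /V [mean _ (fun t => _ - _ *: b) _ _]meanB mean_cst subrK.
have -> : mean m (fun t => G t (y + h) - G t y) x h = U + iB h *: b.
  by rewrite /U [mean _ (fun t => _ - _ *: b) _ _]meanB mean_cst subrK.
rewrite !scalerDr !scalerA [cR _ * iB _]mulrC opprD addrACA subrr addr0.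
apply: le_trans (rnB _ _) _; rewrite !rnZ rn_cR.
have -> : rn (iB h) = B * h.
  by rewrite rn_complex expr0n add0r sqrtr_sqr ger0_norm// mulr_ge0// ltW.
rewrite ger0_norm ?mulr_ge0 ?(ltW A0)// !mulrDl [leRHS]addrC.
by rewrite lerD// ler_wpM2l// mulr_ge0 // ltW.
Qed.

(** The bound [e * h ^+ 2] is additive under quartering, as four times [(h / 2) ^+ 2] is [h ^+ 2].
    It is asked only beyond a threshold depending on the square, so that the thresholds of the four
    quarters can be combined; close to a point of differentiability it holds for every [m]. *)
Lemma goursat_rectangle (e : R) : 0 < e -> exists N, forall m, (N <= m)%N ->
  rn (iB 1 *: (mean m (G 1) 0 1 - mean m (G 0) 0 1)
     - cR A *: (mean m (G ^~ 1) 0 1 - mean m (G ^~ 0) 0 1)) <= e.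
Proof.
move=> e0.
pose P x y h := exists N, forall m, (N <= m)%N -> rn (bdry m x y h) <= e * h ^+ 2.
suff [N NP] : P 0 0 1.
  by exists N => m /NP; rewrite /bdry !add0r expr1n !mulr1.
apply: bisection2.
  move=> x y h h0 [N1 H1] [N2 H2] [N3 H3] [N4 H4].
  (* Level [m.+1] on the square consists of level [m] on the quarters, hence the successor. *)
  exists (maxn (maxn N1 N2) (maxn N3 N4)).+1 => -[//|m].
  rewrite ltnS !geq_max => /andP[/andP[/H1 {}H1 /H2 {}H2] /andP[/H3 {}H3 /H4 {}H4]].
  rewrite bdry_split.
  set a := bdry m x y _ in H1 *; set b := bdry m _ y _ in H2 *.
  set c := bdry m x _ _ in H3 *; set d := bdry m _ _ _ in H4 *.
  have := rnD (a + b) (c + d); have := rnD a b; have := rnD c d.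
  have : h ^+ 2 = 4 * (h / 2) ^+ 2 by field.
  nra.
move=> x y x01 y01; have [b bP] := G_diff x01 y01.
(* A point of the small square differs from [(x, y)] by at most [h] in each coordinate, so its error
   is [2 * h * e']; two such points give [4 * h * e'], which [bdry_le] multiplies by
   [(A + B) * h]. *)
pose e' := e / (4 * (A + B)).
have e'0 : 0 < e' by rewrite divr_gt0// mulr_gt0// addr_gt0.
have [d d0 dP] := bP _ e'0; exists d => // x' y' h hd x'0 xx' _ y'0 yy' _.
exists 0%N => m _.
have -> : e * h ^+ 2 = (A + B) * h * (4 * h * e').
  by rewrite /e'; field; rewrite gt_eqF// addr_gt0.
have near (s t : R) : x' <= s <= x' + h -> y' <= t <= y' + h ->
  rn (G s t - G x y - ((A * (s - x)) +i* (B * (t - y)) : C) *: b) <= 2 * h * e'.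
  move=> sx ty; have sd : `|s - x| <= h by rewrite ler_distl; lra.
  have td : `|t - y| <= h by rewrite ler_distl; lra.
  apply: le_trans (dP s t _ _) _; [lra|lra|nra].
have diff (s t s' t' : R) c : x' <= s <= x' + h -> y' <= t <= y' + h ->
    x' <= s' <= x' + h -> y' <= t' <= y' + h ->
    c = (A * (s - s')) +i* (B * (t - t')) ->
    rn (G s t - G s' t' - c *: b) <= 4 * h * e'.
  move=> sx ty s'x t'y ->.
  have -> : G s t - G s' t' - ((A * (s - s')) +i* (B * (t - t')) : C) *: b =
     (G s t - G x y - ((A * (s - x)) +i* (B * (t - y)) : C) *: b) -
     (G s' t' - G x y - ((A * (s' - x)) +i* (B * (t' - y)) : C) *: b).
    rewrite [X in _ = _ + X]opprD [RHS]addrACA -[X in _ = _ + X]opprD -scalerBl.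
    rewrite opprB [X in _ = X - _]addrA subrK; congr (_ - _ *: _).
    by apply/eqP; rewrite eq_complex /=; apply/andP; split; apply/eqP; lra.
  apply: le_trans (rnB _ _) _.
  by have := near _ _ sx ty; have := near _ _ s'x t'y; lra.
apply: bdry_le => [|s t sx ty]; first lra.
split.
  apply: diff => //; [lra|lra|].
  by rewrite /cR [x' + h - _]addrAC !subrr mulr0 add0r.
apply: diff => //; [lra|lra|].
by rewrite [y' + h - _]addrAC !subrr mulr0 add0r.
Qed.

End Goursat.
End DyadicMean.

(** * The complex exponential *)

Section Scale.
Context {K : numFieldType} {V W : normedModType K}.

(** Registered as an instance, this opens the differentiation rule for bilinear maps to products
    [k y *: f y]. *)
Lemma scale_is_bilinear :
  bilinear_for
    (GRing.Scale.Law.clone _ _ *:%R _) (GRing.Scale.Law.clone _ _ *:%R _)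
    (@GRing.scale K W).
Proof.
split=> [u'|u] a x y /=; first by rewrite scalerDl scalerA.
by rewrite scalerDr !scalerA mulrC.
Qed.

HB.instance Definition _ :=
  bilinear_isBilinear.Build K K W W _ _ (@GRing.scale K W) scale_is_bilinear.

Lemma differentiable_scale (k : V -> K) (f : V -> W) x :
  differentiable k x -> differentiable f x ->
  differentiable (fun y => k y *: f y) x.
Proof.
move=> dk df.
apply: (@differentiable_comp _ _ _ _ (fun y => (k y, f y)) (fun q => q.1 *: q.2)).
  exact: differentiable_pair.
by apply: differentiable_bilin => q; exact: scale_continuous.
Qed.

End Scale.

Section ComplexExponential.
Context {R : realType}.
Local Notation C := (Cplx R).

Lemma real_derive_rem (f : R -> R) (x f' : R) : is_derive x 1 f f' ->
  forall e : R, 0 < e -> exists2 d : R, 0 < d & forall h : R, `|h| < d ->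
    `|f (x + h) - f x - h * f'| <= e * `|h|.
Proof.
move=> [df <-] e e0.
have /eqaddoP/(_ e e0)/nbhs_ballP[d /= d0 H] := derivable_nbhs df.
exists d => // h hd.
have := H h; rewrite -ball_normE /= sub0r normrN => /(_ hd).
by rewrite !fctE/= scaler1 [h + x]addrC opprD addrA.
Qed.

Definition cexp (w : C) : C :=
  (expR (complex.Re w) * cos (complex.Im w)) +i* (expR (complex.Re w) * sin (complex.Im w)).

Lemma cexpD v w : cexp (v + w) = cexp v * cexp w.
Proof.
case: v => a b; case: w => c d; rewrite /cexp /=.
rewrite expRD cosD sinD; apply/eqP; rewrite eq_complex /=.
by apply/andP; split; apply/eqP; ring.
Qed.

Lemma rn_cexp w : rn (cexp w) = expR (complex.Re w).
Proof.
rewrite rn_complex !exprMn -mulrDr cos2Dsin2 mulr1 sqrtr_sqr ger0_norm// expR_ge0.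
Qed.

Lemma cexp_neq0 w : cexp w != 0.
Proof. by rewrite -rn_gt0 rn_cexp expR_gt0. Qed.

Lemma Re_le_rn (z : C) : `|complex.Re z| <= rn z.
Proof. by case: z => x y; rewrite rn_complex -sqrtr_sqr /= ler_wsqrtr// lerDl sqr_ge0. Qed.

Lemma Im_le_rn (z : C) : `|complex.Im z| <= rn z.
Proof. by case: z => x y; rewrite rn_complex -sqrtr_sqr /= ler_wsqrtr// lerDr sqr_ge0. Qed.

Lemma rn_le_ReIm (x y : R) : rn ((x +i* y) : C) <= `|x| + `|y|.
Proof.
have -> : (x +i* y : C) = cR x + (0 +i* y).
  by apply/eqP; rewrite eq_complex /= addr0 add0r !eqxx.
by apply: le_trans (rnD _ _) _; rewrite rn_cR rn_complex expr0n add0r sqrtr_sqr.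
Qed.

Lemma cexp_rem (e : R) : 0 < e -> exists2 d : R, 0 < d & forall h : C, rn h < d ->
  rn (cexp h - 1 - h) <= e * rn h.
Proof.
(* The errors collected below add up to at most [6 * e1 * rn h], so [e / 7] is small enough;
   [e1 <= 1] serves to keep [expR x] below [2]. *)
move=> e0; pose e1 := Num.min 1 (e / 7).
have e10 : 0 < e1 by rewrite lt_min ltr01 divr_gt0.
have e11 : e1 <= 1 by rewrite ge_min lexx.
have e17 : 7 * e1 <= e by rewrite mulrC -ler_pdivlMr// ge_min lexx orbT.
have [d1 d10 H1] := real_derive_rem (is_derive_expR (0 : R)) e10.
have [d2 d20 H2] := real_derive_rem (is_derive_cos (0 : R)) e10.
have [d3 d30 H3] := real_derive_rem (is_derive_sin (0 : R)) e10.
exists (Num.min (Num.min d1 d2) (Num.min d3 (e1 / 2))).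
  by rewrite !lt_min d10 d20 d30 divr_gt0.
case=> x y hd; have := Re_le_rn (x +i* y : C); have := Im_le_rn (x +i* y : C).
set r := rn (x +i* y : C) in hd *; rewrite /=.
move: hd; rewrite !lt_min => /andP[/andP[r1 r2] /andP[r3 r4]] yr xr.
have := H1 x; have := H2 y; have := H3 y.
rewrite !add0r expR0 cos0 sin0 oppr0 mulr0 !mulr1 !subr0 !addr0.
move=> /(_ (le_lt_trans yr r3)) S /(_ (le_lt_trans yr r2)) Co /(_ (le_lt_trans xr r1)) Ex.
have -> : cexp (x +i* y) - 1 - (x +i* y) =
   ((expR x * (cos y - 1) + (expR x - 1 - x)) +i*
    (expR x * (sin y - y) + (expR x - 1) * y)).
  by rewrite /cexp /=; apply/eqP; rewrite eq_complex /=; apply/andP; split; apply/eqP; ring.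
apply: le_trans (rn_le_ReIm _ _) _.
have x0 := normr_ge0 x; have y0 := normr_ge0 y.
have E1 : `|expR x - 1| <= e1.
  have -> : expR x - 1 = (expR x - 1 - x) + x by ring.
  apply: le_trans (ler_normD _ _) _; nra.
have E2 : `|expR x| <= 2.
  have -> : expR x = (expR x - 1) + 1 by ring.
  apply: le_trans (ler_normD _ _) _; rewrite normr1; lra.
have A1 := ler_normD (expR x * (cos y - 1)) (expR x - 1 - x).
have A2 := ler_normD (expR x * (sin y - y)) ((expR x - 1) * y).
rewrite !normrM in A1 A2.
have B1 : `|expR x| * `|cos y - 1| <= 2 * (e1 * `|y|) by rewrite ler_pM.
have B2 : `|expR x| * `|sin y - y| <= 2 * (e1 * `|y|) by rewrite ler_pM.
have B3 : `|expR x - 1| * `|y| <= e1 * `|y| by rewrite ler_wpM2r.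
have r0 : 0 <= r := rn_ge0 _.
have C1 : 7 * e1 * r <= e * r by rewrite ler_wpM2r.
have C2 : e1 * `|x| <= e1 * r by rewrite ler_wpM2l// ltW.
have C3 : e1 * `|y| <= e1 * r by rewrite ler_wpM2l// ltW.
have C4 : 0 <= e1 * r by rewrite mulr_ge0// ltW.
rewrite -mulrA in C1; lra.
Qed.

(** By [cexpD], the expansion at [0] multiplied by [cexp w] is the expansion at [w]. *)
Lemma differentiable_cexp w : differentiable cexp w.
Proof.
suff : is_diff w cexp (fun h => h *: (cexp w : C^o)) by case.
apply: (@rn_diff_intro _ _ _ _ _ _ (rn (cexp w))).
- by move=> a u v; rewrite scalerDl scalerA.
- by move=> v; rewrite rnZ mulrC.
move=> e e0; have w0 : 0 < rn (cexp w) by rewrite rn_gt0 cexp_neq0.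
have [d d0 H] := cexp_rem (divr_gt0 e0 w0); exists d => // h hd.
rewrite cexpD.
have -> : cexp w * cexp h - cexp w - h *: (cexp w : C^o) = cexp w * (cexp h - 1 - h).
  by rewrite /GRing.scale /=; ring.
rewrite rnM; apply: le_trans (ler_wpM2l (ltW w0) (H _ hd)) _.
by rewrite mulrA [rn _ * _]mulrC divfK// gt_eqF.
Qed.

End ComplexExponential.

(** * Cauchy's formula for the derivative *)

Section CauchyMean.
Context {R : realType}.
Local Notation C := (Cplx R).

Definition circ (r t : R) : C :=
  (r * cos (pi *+ 2 * t)) +i* (r * sin (pi *+ 2 * t)).

Lemma circ_cexp (a t : R) : circ (expR a) t = cexp ((a +i* (pi *+ 2 * t)) : C).
Proof. by []. Qed.

Lemma rn_circ (r t : R) : 0 < r -> rn (circ r t) = r.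
Proof. by move=> r0; rewrite -(lnK r0) circ_cexp rn_cexp. Qed.

Lemma circ_neq0 (r t : R) : 0 < r -> circ r t != 0.
Proof. by move=> r0; rewrite -rn_gt0 rn_circ. Qed.

Lemma circ_half (r t : R) : circ r (t + 1 / 2) = - circ r t.
Proof.
rewrite /circ.
have -> : pi *+ 2 * (t + 1 / 2) = pi *+ 2 * t + pi :> R by rewrite mulr2n; lra.
by rewrite cosDpi sinDpi; apply/eqP; rewrite eq_complex /= !mulrN !eqxx.
Qed.

(** Antipodal points cancel: the second half of the parameter interval is the first half turned by
    [pi]. At least one halving is needed to see both halves, hence [m.+1]. *)
Lemma mean_circV (r : R) m : mean m.+1 (fun t => (circ r t)^-1 : C^o) 0 1 = 0.
Proof.
rewrite /= -mean_shift.
rewrite (@eq_mean _ _ (fun t => (circ r (t + 1 / 2))^-1 : C^o)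
  (fun t => (0 : C^o) - (circ r t)^-1)) ?divr_ge0//; last first.
  by move=> t _; rewrite circ_half invrN sub0r.
by rewrite (meanB (fun=> 0)) mean_cst sub0r subrr scaler0.
Qed.

Section Mean.
Context {W : normedModType C}.
Variables (f : C -> W) (rho : R).
Hypothesis fd : forall z : C, rn z < rho -> differentiable f z.

(** With [z = cexp w] one has [dw = dz / z], so [g w dw] is [f z dz / z ^+ 2], whose integral along
    a circle around [0] is [2 pi i] times the derivative of [f] at [0]. *)
Let g (w : C) : W := (cexp w)^-1 *: f (cexp w).

Let g_diff (w : C) : expR (complex.Re w) < rho -> differentiable g w.
Proof.
move=> wr; apply: differentiable_scale.
  by apply: differentiableV; [exact: differentiable_cexp|exact: cexp_neq0].
apply: (@differentiable_comp _ _ _ _ cexp f); first exact: differentiable_cexp.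
by apply: fd; rewrite rn_cexp.
Qed.

Let diffC1 (w v : C) : 'd g w v = v *: 'd g w 1.
Proof. by rewrite -linearZ /= /GRing.scale /= mulr1. Qed.

(* In the logarithmic coordinate the annulus is a rectangle whose two horizontal
   sides cancel by periodicity. *)
Let annulus (a b : R) : a < b -> expR b < rho -> forall e : R, 0 < e ->
  exists N, forall m, (N <= m)%N ->
    rn (mean m (fun t => (circ (expR b) t)^-1 *: f (circ (expR b) t)) 0 1 -
        mean m (fun t => (circ (expR a) t)^-1 *: f (circ (expR a) t)) 0 1) <= e.
Proof.
move=> ab br e e0.
pose A := b - a; have A0 : 0 < A by rewrite subr_gt0.
have pi20 : 0 < pi *+ 2 :> R by rewrite mulrn_wgt0 ?pi_gt0.
pose w (x y : R) : C := (a + A * x) +i* (pi *+ 2 * y).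
pose G (x y : R) := g (w x y).
have Gd (x y : R) : 0 <= x <= 1 -> 0 <= y <= 1 -> exists b : W,
  forall e : R, 0 < e -> exists2 d : R, 0 < d & forall x' y' : R,
    `|x' - x| < d -> `|y' - y| < d ->
    rn (G x' y' - G x y - ((A * (x' - x)) +i* (pi *+ 2 * (y' - y)) : C) *: b)
      <= e * (`|x' - x| + `|y' - y|).
  move=> x01 y01; exists ('d g (w x y) 1) => e' e'0.
  pose S := A + pi *+ 2; have S0 : 0 < S by rewrite addr_gt0.
  have wd : differentiable g (w x y).
    apply: g_diff; rewrite /=; apply: le_lt_trans br; rewrite ler_expR /A; nra.
  have [d d0 H] := rn_diff wd (divr_gt0 e'0 S0).
  exists (d / (2 * S)); first by rewrite divr_gt0// mulr_gt0.
  move=> x' y'; rewrite !ltr_pdivlMr ?mulr_gt0// => x'd y'd.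
  rewrite -diffC1; set v : C := (_ +i* _).
  have vS : rn v <= S * (`|x' - x| + `|y' - y|).
    apply: le_trans (rn_le_ReIm _ _) _; rewrite !normrM (gtr0_norm A0) (gtr0_norm pi20).
    have := normr_ge0 (x' - x); have := normr_ge0 (y' - y); rewrite /S; nra.
  have -> : G x' y' = g (w x y + v).
    by congr g; apply/eqP; rewrite eq_complex /=; apply/andP; split; apply/eqP; ring.
  apply: le_trans (H v _) _; first by apply: le_lt_trans vS _; lra.
  by rewrite mulrAC ler_pdivrMr// -mulrA [_ * S]mulrC ler_wpM2l// ltW.
(* The vertical sides enter with the factor [2 pi i], so the tolerance is multiplied by [2 pi]
   beforehand. *)
have [N NP] := goursat_rectangle A0 pi20 Gd (mulr_gt0 pi20 e0).
exists N => m /NP.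
have G1 (x : R) : G x 1 = G x 0.
  rewrite /G /g; suff -> : cexp (w x 1) = cexp (w x 0) by [].
  by rewrite /cexp /= mulr1 mulr0 -[pi *+ 2]add0r cosD2pi sinD2pi.
have -> : G^~ 1 = G^~ 0 by apply/funext => x; exact: G1.
rewrite subrr scaler0 subr0 rnZ rn_complex expr0n add0r sqrtr_sqr mulr1 gtr0_norm//.
rewrite ler_pM2l//.
have GE x : G x = fun t => (circ (expR (a + A * x)) t)^-1 *: f (circ (expR (a + A * x)) t).
  by [].
have aA : a + A = b by rewrite /A; lra.
by rewrite !GE mulr1 mulr0 addr0 aA.
Qed.

(** [annulus] replaces the radius [r] by a small [s] at the cost of [e / 2]. On the small circle
    [f c / c] is [f 0 / c] plus the derivative up to [e / 2], by differentiability at [0], and the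
    average of [f 0 / c] is exactly [0] by [mean_circV]. *)
Lemma cauchy_mean (r : R) : 0 < r -> r < rho -> forall e : R, 0 < e ->
  exists N, forall m, (N <= m)%N ->
    rn (mean m (fun t => (circ r t)^-1 *: f (circ r t)) 0 1 - 'd f 0 1) <= e.
Proof.
move=> r0 rrho e e0; have e20 : 0 < e / 2 by lra.
have f0 : differentiable f 0 by apply: fd; rewrite rn0; lra.
have [d d0 H] := rn_diff f0 e20.
pose s := Num.min (d / 2) (r / 2).
have s0 : 0 < s by rewrite lt_min !divr_gt0.
have sd : s < d by rewrite gt_min; apply/orP; left; lra.
have sr : s < r by rewrite gt_min; apply/orP; right; lra.
have lnsr : ln s < ln r by rewrite ltr_ln ?posrE.
have [|N NP] := annulus lnsr _ e20; first by rewrite lnK.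
exists N.+1 => -[//|m]; rewrite ltnS => Nm; have := NP m.+1 (leqW Nm).
rewrite !lnK// => near_s.
apply: le_trans (rn_tri (mean m.+1 (fun t => (circ s t)^-1 *: f (circ s t)) 0 1) _ _) _.
suff : rn (mean m.+1 (fun t => (circ s t)^-1 *: f (circ s t)) 0 1 - 'd f 0 1) <= e / 2 by lra.
have <- : mean m.+1 (fun t => (circ s t)^-1 *: f (circ s t) - (circ s t)^-1 *: f 0 - 'd f 0 1) 0 1 =
  mean m.+1 (fun t => (circ s t)^-1 *: f (circ s t)) 0 1 - 'd f 0 1.
  rewrite (meanB (fun t => _ - _)) mean_cst meanB mean_scale mean_circV scale0r.
  by rewrite subr0.
apply: mean_le => // t _; set c := circ s t.
have cs : rn c = s by exact: rn_circ.
have c0 : c != 0 by exact: circ_neq0.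
have -> : c^-1 *: f c - c^-1 *: f 0 - 'd f 0 1 = c^-1 *: (f (0 + c) - f 0 - 'd f 0 c).
  rewrite add0r 2!scalerBr; congr (_ - _); rewrite -linearZ /=; congr ('d f 0 _).
  by rewrite /GRing.scale /= mulVf.
rewrite rnZ rnV cs mulrC ler_pdivrMr// -cs.
by apply: H; rewrite cs.
Qed.

End Mean.
End CauchyMean.

(** * Cauchy estimates and Taylor's formula *)

Section MeanValue.
Context {R : realType}.
Local Notation C := (Cplx R).
Context {V W : normedModType C}.

(** The bound [(K + e) * h] on the increment over an interval of length [h] is additive under
    halving. Locally, both ends are compared with a point [x] of the interval: as [x] lies between
    them, the errors, proportional to the distances from [x], add up to [e * h]. *)
Lemma mean_value_ineq (f : V -> W) (a v : V) (K : R) :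
  (forall t : R, 0 <= t <= 1 -> differentiable f (a + cR t *: v) /\
     rn ('d f (a + cR t *: v) v) <= K) ->
  rn (f (a + v) - f a) <= K.
Proof.
move=> H; apply/ler_addgt0Pr => e e0.
pose P (x h : R) := rn (f (a + cR (x + h) *: v) - f (a + cR x *: v)) <= (K + e) * h.
suff : P 0 1 by rewrite /P add0r cR0 cR1 scale0r scale1r addr0 mulr1.
apply: (@bisection _ P) => [x h h0|x x01]; rewrite /P.
  rewrite -addrA -splitr => H1 H2.
  apply: le_trans (rn_tri (f (a + cR (x + h / 2) *: v)) _ _) _.
  have : (K + e) * h = (K + e) * (h / 2) + (K + e) * (h / 2) by rewrite -mulrDr -splitr.
  lra.
have [fd fK] := H x x01.
have v1 : 0 < rn v + 1 by rewrite ltr_wpDl ?rn_ge0.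
have [d d0 dH] := rn_diff fd (divr_gt0 e0 v1).
have near (s : R) : `|s - x| * (rn v + 1) < d ->
    rn (f (a + cR s *: v) - f (a + cR x *: v) - cR (s - x) *: 'd f (a + cR x *: v) v)
      <= e * `|s - x|.
  move=> sx.
  have E : a + cR s *: v = a + cR x *: v + cR (s - x) *: v.
    have xs : x + (s - x) = s by lra.
    by rewrite -addrA -scalerDl -cRD xs.
  rewrite E -linearZ /=.
  have sv : rn (cR (s - x) *: v) <= `|s - x| * (rn v + 1).
    by rewrite rnZ rn_cR ler_wpM2l// lerDl.
  apply: le_trans (dH _ _) _; first exact: le_lt_trans sv sx.
  by rewrite mulrAC ler_pdivrMr// -mulrA ler_wpM2l// ltW.
exists (d / (rn v + 1)); first exact: divr_gt0.
move=> y h /andP[h0]; rewrite ltr_pdivlMr// => hd y0 xy yh.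
have := near y; have := near (y + h).
rewrite (ger0_norm (x := y + h - x)) ?(ler0_norm (x := y - x)); [|lra|lra].
have yv : - (y - x) * (rn v + 1) < d.
  by apply: le_lt_trans hd; apply: (ler_wpM2r (ltW v1)); lra.
have yhv : (y + h - x) * (rn v + 1) < d.
  by apply: le_lt_trans hd; apply: (ler_wpM2r (ltW v1)); lra.
move=> /(_ yhv) N1 /(_ yv) N2.
set D := 'd f _ v in N1 N2 fK *.
have -> : f (a + cR (y + h) *: v) - f (a + cR y *: v) =
  (f (a + cR (y + h) *: v) - f (a + cR x *: v) - cR (y + h - x) *: D)
  - (f (a + cR y *: v) - f (a + cR x *: v) - cR (y - x) *: D) + cR h *: D.
  have -> : cR (y + h - x) = cR (y - x) + cR h by rewrite -cRD addrAC.
  rewrite scalerDl; abelian.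
apply: le_trans (rnD _ _) _; apply: le_trans (lerD (rnB _ _) (lexx _)) _.
rewrite [rn (cR h *: D)]rnZ rn_cR (gtr0_norm h0) mulrDl.
have : h * rn D <= K * h by rewrite mulrC ler_wpM2r// ltW.
lra.
Qed.

End MeanValue.

(** * Cauchy estimates along complex lines, and the quadratic Taylor bound *)

Section CauchyEstimates.
Context {R : realType}.
Local Notation C := (Cplx R).
Context {V W : normedModType C}.

Lemma is_diff_line (p v : V) (z : C) :
  is_diff z (fun w : C => p + w *: v) (fun w : C => w *: v).
Proof.
have := is_diffD (is_diff_cst p z) (is_diff_scalel z v).
by move=> H; apply: is_diff_eq; apply/funext => w /=; rewrite !fctE /= add0r.
Qed.

Lemma diff_line (f : V -> W) (p v : V) (z : C) : differentiable f (p + z *: v) ->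
  differentiable (fun w : C => f (p + w *: v)) z /\
  'd (fun w : C => f (p + w *: v)) z 1 = 'd f (p + z *: v) v.
Proof.
move=> fd; have [ld lE] := is_diff_line p v z.
split; first exact: (@differentiable_comp _ _ _ _ (fun w : C => p + w *: v) f).
by rewrite (diff_comp ld fd) /= lE scale1r.
Qed.

Variables (f : V -> W) (p : V) (rho M : R).
Hypothesis fd : forall q, rn (q - p) < rho -> differentiable f q.

Lemma cauchy_mean_dir (q v : V) (r : R) : 0 < r -> rn (q - p) + r * rn v < rho ->
  forall e : R, 0 < e -> exists N, forall m, (N <= m)%N ->
  rn (mean m (fun t => (circ r t)^-1 *: f (q + circ r t *: v)) 0 1 - 'd f q v) <= e.
Proof.
move=> r0 qv; have v0 := rn_ge0 v.
(* A disc slightly larger than that of radius [r] still maps into the ball; adding [1] to [rn v]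
   keeps the quotient meaningful for [v = 0]. *)
pose d := (rho - rn (q - p) - r * rn v) / (rn v + 1).
have v1 : 0 < rn v + 1 by rewrite ltr_wpDl.
have d0 : 0 < d by rewrite divr_gt0//; lra.
have dv : d * (rn v + 1) = rho - rn (q - p) - r * rn v by rewrite divfK// gt_eqF.
have near (z : C) : rn z < r + d -> differentiable f (q + z *: v).
  move=> zr; apply: fd.
  have -> : q + z *: v - p = (q - p) + z *: v by abelian.
  apply: le_lt_trans (rnD _ _) _; rewrite rnZ; nra.
have q0 : differentiable f (q + 0 *: v) by apply: near; rewrite rn0; lra.
have := (diff_line q0).2; rewrite scale0r addr0 => <-.
apply: (@cauchy_mean _ _ (fun z : C => f (q + z *: v)) (r + d)) => //; last lra.
by move=> z /near/diff_line[].
Qed.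

Hypothesis fM : forall q, rn (q - p) < rho -> rn (f q) <= M.

Lemma cauchy_estimate (q v : V) (r : R) : 0 < r -> rn (q - p) + r * rn v < rho ->
  rn ('d f q v) <= M / r.
Proof.
move=> r0 qv; apply/ler_addgt0Pr => e e0.
have [N /(_ N (leqnn _))] := cauchy_mean_dir r0 qv e0.
set S := mean _ _ _ _ => H.
have SM : rn S <= M / r.
  apply: mean_le => // t _; rewrite rnZ rnV rn_circ// mulrC ler_pM2r ?invr_gt0//.
  apply: fM; have -> : q + circ r t *: v - p = (q - p) + circ r t *: v by abelian.
  by apply: le_lt_trans (rnD _ _) _; rewrite rnZ rn_circ//.
have -> : 'd f q v = S - (S - 'd f q v) by abelian.
by have := rnB S (S - 'd f q v); lra.
Qed.

(** Cauchy's formula is used twice. The difference of the two differentials is a limit of averages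
    of [f (w + u) - f w] divided by the circle points of radius [r], and the mean value inequality
    with [cauchy_estimate] at radius [s] bounds each increment by [M / s]. *)
Lemma cauchy_estimate_diff (q u v : V) (r s : R) : 0 < r -> 0 < s ->
  rn (q - p) + rn u + r * rn v + s * rn u < rho ->
  rn ('d f (q + u) v - 'd f q v) <= M / (r * s).
Proof.
move=> r0 s0 quv; apply/ler_addgt0Pr => e e0; have e20 : 0 < e / 2 by lra.
have u0 := rn_ge0 u; have su0 : 0 <= s * rn u by rewrite mulr_ge0// ltW.
have qu : rn (q + u - p) <= rn (q - p) + rn u.
  have -> : q + u - p = (q - p) + u by abelian.
  exact: rnD.
have [|N1 H1] := @cauchy_mean_dir (q + u) v _ r0 _ _ e20; first lra.
have [|N2 H2] := @cauchy_mean_dir q v _ r0 _ _ e20; first lra.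
have := H1 (maxn N1 N2) (leq_maxl _ _); have := H2 (maxn N1 N2) (leq_maxr _ _).
set m := maxn _ _; set S2 := mean m _ _ _; set S1 := mean m _ _ _ => L2 L1.
have SM : rn (S1 - S2) <= M / (r * s).
  rewrite -meanB; apply: mean_le => // t _; rewrite -scalerBr rnZ rnV rn_circ//.
  rewrite invfM mulrA [_ / r]mulrC -mulrA ler_pM2l ?invr_gt0//.
  have -> : q + u + circ r t *: v = q + circ r t *: v + u by abelian.
  apply: mean_value_ineq => x x01.
  have near : rn (q + circ r t *: v + cR x *: u - p) <= rn (q - p) + r * rn v + rn u.
    have -> : q + circ r t *: v + cR x *: u - p = (q - p) + circ r t *: v + cR x *: u.
      by abelian.
    apply: le_trans (rnD _ _) _; apply: lerD.
      by apply: le_trans (rnD _ _) _; rewrite rnZ rn_circ//.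
    by rewrite rnZ rn_cR ger0_norm; nra.
  split; first by apply: fd; lra.
  by apply: cauchy_estimate => //; lra.
have -> : 'd f (q + u) v - 'd f q v =
  (S1 - S2) - (S1 - 'd f (q + u) v) + (S2 - 'd f q v) by abelian.
have := rnD ((S1 - S2) - (S1 - 'd f (q + u) v)) (S2 - 'd f q v).
have := rnB (S1 - S2) (S1 - 'd f (q + u) v).
lra.
Qed.

(** The remainder is the increment of [f - 'd f q], whose differential at a point of the segment is
    a difference of differentials of [f]. The room [(1 + 2 * r) * rn v] pays for the segment and for
    the two radii of [cauchy_estimate_diff], both equal to [r]. *)
Lemma taylor_estimate (q v : V) (r : R) : 0 < r ->
  rn (q - p) + (1 + 2 * r) * rn v < rho ->
  rn (f (q + v) - f q - 'd f q v) <= M / r ^+ 2.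
Proof.
move=> r0 qv.
pose h (w : V) := f w - 'd f q w.
have v0 := rn_ge0 v; have q0 := rn_ge0 (q - p).
have rv : 0 <= r * rn v by rewrite mulr_ge0// ltW.
have fq : differentiable f q by apply: fd; lra.
have -> : f (q + v) - f q - 'd f q v = h (q + v) - h q.
  by rewrite /h linearD; abelian.
apply: mean_value_ineq => t t01.
have tv : rn (cR t *: v) <= rn v by rewrite rnZ rn_cR ger0_norm; nra.
have near : rn (q + cR t *: v - p) <= rn (q - p) + rn v.
  have -> : q + cR t *: v - p = (q - p) + cR t *: v by abelian.
  by apply: le_trans (rnD _ _) _; rewrite lerD2l.
have ft : differentiable f (q + cR t *: v) by apply: fd; lra.
have Ld : differentiable ('d f q) (q + cR t *: v).
  exact: linear_differentiable (diff_continuous fq).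
have hE : h = f \- 'd f q by [].
split; first exact: differentiableB.
rewrite hE diffB// /= [in X in _ - X]diff_lin; last exact: diff_continuous.
apply: cauchy_estimate_diff => //.
have : r * rn (cR t *: v) <= r * rn v by rewrite ler_wpM2l// ltW.
lra.
Qed.

Lemma taylor_quadratic (q v : V) : 0 < rho -> rn (q - p) <= rho / 2 -> rn v <= rho / 8 ->
  rn (f (q + v) - f q - 'd f q v) <= 64 * M / rho ^+ 2 * rn v ^+ 2.
Proof.
move=> rho0 qp v8; have [->|v0] := eqVneq v 0.
  by rewrite addr0 subrr sub0r linear0 oppr0 !rn0 expr0n /= mulr0.
rewrite -rn_gt0 in v0.
(* Then [(1 + 2 * r) * rn v] is [rn v + rho / 4], at most [3 * rho / 8], which fits beside
   [rho / 2]; and [M / r ^+ 2] is quadratic in [rn v]. *)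
pose r := rho / (8 * rn v).
have r0 : 0 < r by rewrite divr_gt0// mulr_gt0.
have rv : r * rn v = rho / 8 by rewrite /r; field; rewrite gt_eqF.
have -> : 64 * M / rho ^+ 2 * rn v ^+ 2 = M / r ^+ 2.
  by rewrite /r; field; rewrite !gt_eqF.
apply: taylor_estimate => //; lra.
Qed.

End CauchyEstimates.

(** * Limits of holomorphic maps *)

Section SequenceLimits.
Context {R : realType}.
Local Notation C := (Cplx R).

Definition slim (W : normedModType C) (u : nat -> W) (l : W) : Prop :=
  forall e : R, 0 < e -> exists N, forall k, (N <= k)%N -> rn (u k - l) <= e.

Definition scauchy (W : normedModType C) (u : nat -> W) : Prop :=
  forall e : R, 0 < e -> exists N, forall j k, (N <= j)%N -> (N <= k)%N ->
    rn (u j - u k) <= e.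

(** A [normedModType] need not be complete, so completeness is carried as a hypothesis and supplied
    for [C] and for matrices. *)
Definition scomplete (W : normedModType C) : Prop :=
  forall u : nat -> W, scauchy u -> exists l, slim u l.

Section W.
Context {W : normedModType C}.
Implicit Types (u v : nat -> W) (l : W).

Lemma slim_cst l : slim (fun=> l) l.
Proof. by move=> e e0; exists 0%N => k _; rewrite subrr rn0 ltW. Qed.

Lemma slimD u v l l' : slim u l -> slim v l' -> slim (fun k => u k + v k) (l + l').
Proof.
move=> ul vl e e0; have e20 : 0 < e / 2 by lra.
have [N1 H1] := ul _ e20; have [N2 H2] := vl _ e20.
exists (maxn N1 N2) => k; rewrite geq_max => /andP[/H1 h1 /H2 h2].
have -> : u k + v k - (l + l') = (u k - l) + (v k - l') by abelian.
by have := rnD (u k - l) (v k - l'); lra.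
Qed.

Lemma slimZ u l (a : C) : slim u l -> slim (fun k => a *: u k) (a *: l).
Proof.
move=> ul e e0; have a0 := rn_ge0 a.
have a1 : 0 < rn a + 1 by rewrite ltr_wpDl.
have [N H] := ul _ (divr_gt0 e0 a1); exists N => k /H.
rewrite ler_pdivlMr// -scalerBr rnZ => h.
by have := rn_ge0 (u k - l); nra.
Qed.

Lemma slim_eq u v l : slim u l -> (forall k, u k = v k) -> slim v l.
Proof. by move=> ul uv e /ul[N H]; exists N => k /H; rewrite uv. Qed.

Lemma slim_eq_lim u l l' : slim u l -> l = l' -> slim u l'.
Proof. by move=> + <-. Qed.

Lemma slimB u v l l' : slim u l -> slim v l' -> slim (fun k => u k - v k) (l - l').
Proof.
move=> ul /(slimZ (-1)); rewrite scaleN1r => vl.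
by apply: slim_eq (slimD ul vl) _ => k; rewrite scaleN1r.
Qed.

Lemma slim_le u l (K : R) : slim u l -> (forall k, rn (u k) <= K) -> rn l <= K.
Proof.
move=> ul uK; apply/ler_addgt0Pr => e e0; have [N /(_ N (leqnn _)) H] := ul _ e0.
have -> : l = u N - (u N - l) by abelian.
by have := rnB (u N) (u N - l); have := uK N; lra.
Qed.

Lemma slim_unique u l l' : slim u l -> slim u l' -> l = l'.
Proof.
move=> ul ul'; apply/eqP; rewrite -subr_eq0 -rn_eq0 eq_le rn_ge0 andbT.
by apply: slim_le (slimB ul ul') _ => k; rewrite subrr rn0.
Qed.

End W.

Lemma scomplete_C : scomplete (C : normedModType C).
Proof.
move=> u uc.
have part (p : C -> R) : (forall z w : C, `|p z - p w| <= rn (z - w)) ->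
    exists x, forall e : R, 0 < e -> exists N, forall k, (N <= k)%N -> `|p (u k) - x| <= e.
  move=> pr.
  have : cauchy (p (u k) @[k --> \oo]).
    apply/cauchy_ballP => e e0; have e20 : 0 < e / 2 by lra.
    have [N H] := uc _ e20.
    pose T := [set x | exists2 k, (N <= k)%N & x = p (u k)]; exists (T, T).
      by split; exists N => // k /= Nk; exists k.
    move=> [x y] /= [[j Nj ->] [k Nk ->]]; rewrite -ball_normE /=.
    by apply: le_lt_trans (pr _ _) _; apply: le_lt_trans (H _ _ Nj Nk) _; lra.
  move=> /cauchy_cvg/cvg_ex[x /cvgrPdist_le H]; exists x => e e0.
  by have [N _ NH] := H e e0; exists N => k /NH; rewrite distrC.
have [x xP] : exists x : R, forall e : R, 0 < e -> exists N, forall k, (N <= k)%N ->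
    `|complex.Re (u k) - x| <= e.
  by apply: part => -[a b] [c d]; exact: (Re_le_rn (a +i* b - (c +i* d) : C)).
have [y yP] : exists x : R, forall e : R, 0 < e -> exists N, forall k, (N <= k)%N ->
    `|complex.Im (u k) - x| <= e.
  by apply: part => -[a b] [c d]; exact: (Im_le_rn (a +i* b - (c +i* d) : C)).
exists (x +i* y) => e e0; have e20 : 0 < e / 2 by lra.
have [N1 H1] := xP _ e20; have [N2 H2] := yP _ e20.
exists (maxn N1 N2) => k; rewrite geq_max => /andP[/H1 h1 /H2 h2].
case: (u k) h1 h2 => a b /= h1 h2.
have := rn_le_ReIm (a - x) (b - y); rewrite -[in rn _]/(a +i* b - (x +i* y) : C).
lra.
Qed.

Lemma rn_mx_coord m n (A : 'M[C]_(m, n)) i j : rn (A i j) <= rn A.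
Proof.
rewrite -cR_le -!normE [leRHS]/Num.norm /= mx_normE.
have -> : `|A i j| = (`|A i j|%:nng)%:num by [].
rewrite num_le.
exact: (le_bigmax _ (fun ij : 'I_m * 'I_n => `|A ij.1 ij.2|%:nng) (i, j)).
Qed.

Lemma rn_mx_le m n (A : 'M[C]_(m, n)) (K : R) : 0 <= K ->
  (forall i j, rn (A i j) <= K) -> rn A <= K.
Proof.
move=> K0 AK; rewrite -cR_le -normE /Num.norm /=.
have [->|/mx_norm_neq0[[i j] ->]] := eqVneq (mx_norm A) 0; first by rewrite -cR0 cR_le.
by rewrite normE cR_le.
Qed.

Lemma scomplete_mx m n : scomplete ('M[C]_(m, n) : normedModType C).
Proof.
move=> u uc.
have /choice[l lP] (ij : 'I_m * 'I_n) : exists l : C, slim (fun k => u k ij.1 ij.2) l.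
  apply: scomplete_C => e /uc[N H]; exists N => j k Nj Nk.
  apply: le_trans (H _ _ Nj Nk).
  have -> : u j ij.1 ij.2 - u k ij.1 ij.2 = (u j - u k) ij.1 ij.2 by rewrite !mxE.
  exact: rn_mx_coord.
exists (\matrix_(i, j) l (i, j)) => e e0.
have /choice[N NP] (ij : 'I_m * 'I_n) := lP ij e e0.
exists (\max_ij N ij) => k Nk; apply: rn_mx_le; first exact: ltW.
move=> i j; have := NP (i, j) k; rewrite !mxE; apply.
by apply: leq_trans Nk; exact: leq_bigmax.
Qed.

Lemma rn_pair (V W : normedModType C) (x : V * W) : rn x = Num.max (rn x.1) (rn x.2).
Proof.
apply: (@complexI R); rewrite -[LHS]/(cR _) -normE prod_normE !normE.
by case: leP => h; [rewrite max_r ?cR_le|rewrite max_l ?cR_le// ltW].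
Qed.

End SequenceLimits.

(** * Weierstrass' theorem for pointwise limits of uniformly bounded holomorphic maps *)

Section Weierstrass.
Context {R : realType}.
Local Notation C := (Cplx R).
Context {V W : normedModType C}.
Variables (f : nat -> V -> W) (g : V -> W) (p : V) (rho M : R).
Hypotheses (W_complete : scomplete W) (rho0 : 0 < rho).
Hypothesis fd : forall k q, rn (q - p) < rho -> differentiable (f k) q.
Hypothesis fM : forall k q, rn (q - p) < rho -> rn (f k q) <= M.
Hypothesis fg : forall q, rn (q - p) < rho -> slim (f ^~ q) (g q).

Let center_half : rn (p - p) <= rho / 2. Proof. by rewrite subrr rn0; have := rho0; lra. Qed.

Let K := 64 * M / rho ^+ 2.

Let taylor k v : rn v <= rho / 8 ->
  rn (f k (p + v) - f k p - 'd (f k) p v) <= K * rn v ^+ 2.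
Proof. exact: (taylor_quadratic (fd k) (fM k)). Qed.

(* The differentials are abstracted as [D] to keep unification from unfolding them. *)
Let diff_cvg_abstract (D : nat -> V -> W) v :
  (forall k (a : C) w, D k (a *: w) = a *: D k w) ->
  (forall k w, rn w <= rho / 8 -> rn (f k (p + w) - f k p - D k w) <= K * rn w ^+ 2) ->
  exists l, slim (D ^~ v) l.
Proof.
move=> DZ Dtaylor; have r0 := rho0; apply: W_complete => e e0.
have v1 : 0 < rn v + 1 by rewrite ltr_wpDl ?rn_ge0.
pose B := `|K| * (rn v + 1) ^+ 2 + 1.
have B0 : 0 < B by rewrite ltr_wpDl// mulr_ge0// sqr_ge0.
(* Difference quotients with the fixed step [s] are compared. The first bound keeps [s v] in the
   range of the Taylor estimate, the second makes each of the two remainders at most [s * e / 4];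
   the four convergence errors, at [p] and [p + s v] for [j] and [k], are [s * e / 8] each, and the
   total is [s * e]. *)
pose s := Num.min (rho / (8 * (rn v + 1))) (e / (4 * B)).
have s0 : 0 < s by rewrite lt_min !divr_gt0// mulr_gt0.
have sv : s * (rn v + 1) <= rho / 8.
  rewrite -ler_pdivlMr// /s; rewrite ge_min; apply/orP; left.
  by rewrite invfM mulrA.
have sB : s * B <= e / 4.
  rewrite -ler_pdivlMr// /s ge_min; apply/orP; right.
  by rewrite invfM mulrA.
have svr : rn (cR s *: v) <= s * (rn v + 1).
  by rewrite rnZ rn_cR gtr0_norm// ler_wpM2l ?(ltW s0)// lerDl.
have sK : K * rn (cR s *: v) ^+ 2 <= s * (e / 4).
  apply: le_trans (_ : `|K| * (s * (rn v + 1)) ^+ 2 <= _).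
    apply: le_trans (ler_wpM2r (sqr_ge0 _) (ler_norm K)) _.
    by rewrite ler_wpM2l// lerXn2r ?nnegrE ?rn_ge0// mulr_ge0// ltW.
  rewrite exprMn mulrCA expr2 -mulrA ler_wpM2l ?(ltW s0)//.
  by apply: le_trans sB; rewrite ler_wpM2l ?(ltW s0)// lerDl.
have sv8 : rn (cR s *: v) <= rho / 8 by apply: le_trans sv.
have inb : rn (p + cR s *: v - p) < rho.
  by rewrite addrAC subrr add0r; apply: le_lt_trans sv8 _; lra.
have inp : rn (p - p) < rho by rewrite subrr rn0.
have e8 : 0 < s * (e / 8) by rewrite mulr_gt0//; lra.
have [N1 H1] := fg inb e8; have [N2 H2] := fg inp e8.
exists (maxn N1 N2) => j k.
rewrite !geq_max => /andP[/H1 h1 /H2 h2] /andP[/H1 h3 /H2 h4].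
have := Dtaylor j _ sv8; have := Dtaylor k _ sv8.
rewrite !DZ; move: (D j v) (D k v) => Dj Dk.
set Fj := f j (p + _) in h1 *; set Fk := f k (p + _) in h3 *.
set G := g (p + _) in h1 h3; move=> Tk Tj.
rewrite -(ler_pM2l s0) -{1}(gtr0_norm s0) -rn_cR -rnZ scalerBr.
have -> : cR s *: Dj - cR s *: Dk = ((Fj - G) - (Fk - G)) - ((f j p - g p) - (f k p - g p))
   - ((Fj - f j p - cR s *: Dj) - (Fk - f k p - cR s *: Dk)) by abelian.
apply: le_trans (rnB _ _) _; apply: le_trans (lerD (rnB _ _) (rnB _ _)) _.
apply: le_trans (lerD (lerD (rnB _ _) (rnB _ _)) (lexx _)) _.
have : s * e = s * (e / 8) * 8 by field.
lra.
Qed.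

Let diff_cvg v : exists l, slim (fun k => 'd (f k) p v) l.
Proof.
apply: (@diff_cvg_abstract (fun k => 'd (f k) p)) => [k a w|]; last exact: taylor.
exact: linearZ_LR.
Qed.

(* The quadratic Taylor bounds are uniform in [k], so they force the differentials
   to converge and pass to the limit. *)
Lemma weierstrass_diff : differentiable g p /\
  forall v, slim (fun k => 'd (f k) p v) ('d g p v).
Proof.
have r0 := rho0; have [L LP] := choice diff_cvg.
suff [gd gL] : is_diff p g L.
  split=> [|v]; first exact: gd.
  exact: (slim_eq_lim (LP v) (esym (congr1 (fun h : V -> W => h v) gL))).
(* This is the Cauchy estimate with radius [rho / (2 * rn v)]; being uniform in [k], it passes to
   [L]. *)
apply: (@rn_diff_intro _ _ _ _ _ _ (2 * M / rho)).
- move=> a u v; apply: (slim_unique (LP _)).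
  by apply: slim_eq (slimD (slimZ a (LP u)) (LP v)) _ => k; rewrite linearP.
- move=> v; apply: slim_le (LP v) _ => k.
  have [->|] := eqVneq v 0; first by rewrite linear0 !rn0 mulr0.
  rewrite -rn_gt0 => v0.
  have -> : 2 * M / rho * rn v = M / (rho / (2 * rn v)).
    by field; rewrite !gt_eqF.
  apply: (cauchy_estimate (fd k) (fM k)); first by rewrite divr_gt0// mulr_gt0.
  rewrite subrr rn0 add0r.
  have -> : rho / (2 * rn v) * rn v = rho / 2 by field; rewrite gt_eqF.
  lra.
move=> e e0.
have K1 : 0 < `|K| + 1 by rewrite ltr_wpDl.
exists (Num.min (rho / 8) (e / (`|K| + 1))).
  by rewrite lt_min !divr_gt0.
move=> v; rewrite lt_min => /andP[v8]; rewrite ltr_pdivlMr// => vK.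
have inb : rn (p + v - p) < rho by rewrite addrAC subrr add0r; lra.
have inp : rn (p - p) < rho by rewrite subrr rn0.
have v0 := rn_ge0 v.
have Kv : K * rn v ^+ 2 <= e * rn v.
  rewrite expr2 mulrA; apply: ler_wpM2r => //.
  apply: le_trans (ler_wpM2r v0 (ler_norm K)) _; apply: ltW; apply: le_lt_trans vK.
  by rewrite mulrC ler_wpM2l// lerDl.
apply: le_trans Kv; apply: slim_le (slimB (slimB (fg inb) (fg inp)) (LP v)) _ => k.
by apply: taylor; exact: ltW.
Qed.

End Weierstrass.

(** * Holomorphy of the Hamiltonian vector field *)

Section Differentiability.
Context {R : realType}.
Local Notation C := (Cplx R).

Lemma differentiable_near_eq (V W : normedModType C) (f g : V -> W) p :
  differentiable f p -> {near p, f =1 g} -> differentiable g p.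
Proof.
move=> fd fg.
have [_ /posC[K K0 ->] LK] := linear_lipschitz (diff_continuous fd).
suff [] : is_diff p g ('d f p) by [].
apply: (@rn_diff_intro _ _ _ _ _ _ K).
- by move=> a u v; exact: linearP.
- by move=> v; rewrite -cR_le cRM -!normE; exact: LK.
move=> e e0; have [d1 d10 H1] := rn_diff fd e0.
have /rn_nearP[d2 d20 H2] := fg.
exists (Num.min d1 d2); first by rewrite lt_min d10.
move=> v; rewrite lt_min => /andP[v1 v2].
rewrite -(H2 (p + v)); last by rewrite addrAC subrr add0r.
rewrite -(H2 p); last by rewrite subrr rn0.
exact: H1.
Qed.

Section Sums.
Context {V : normedModType C}.

Lemma differentiable_mul (f g : V -> C) p : differentiable f p -> differentiable g p ->
  differentiable (fun x => f x * g x : C) p.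
Proof. exact: differentiableM. Qed.

Lemma differentiable_bigsum (W : normedModType C) (I : Type) (r : seq I) (P : pred I)
    (F : I -> V -> W) p : (forall i, differentiable (F i) p) ->
  differentiable (fun x => \sum_(i <- r | P i) F i x) p.
Proof.
move=> Fd; elim: r => [|i r IH].
  rewrite (_ : (fun x => _) = cst 0); first exact: differentiable_cst.
  by apply/funext => x; rewrite big_nil.
case Pi : (P i); last first.
  rewrite (_ : (fun x => _) = (fun x => \sum_(i <- r | P i) F i x))//.
  by apply/funext => x; rewrite big_cons Pi.
rewrite (_ : (fun x => _) = F i + (fun x => \sum_(i <- r | P i) F i x)).
  exact: differentiableD.
by apply/funext => x; rewrite big_cons Pi.
Qed.

Lemma differentiable_bigprod (I : Type) (r : seq I) (P : pred I)
    (F : I -> V -> C) p : (forall i, differentiable (F i) p) ->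
  differentiable (fun x => \prod_(i <- r | P i) F i x) p.
Proof.
move=> Fd; elim: r => [|i r IH].
  rewrite (_ : (fun x => _) = cst 1); first exact: differentiable_cst.
  by apply/funext => x; rewrite big_nil.
case Pi : (P i); last first.
  rewrite (_ : (fun x => _) = (fun x => \prod_(i <- r | P i) F i x))//.
  by apply/funext => x; rewrite big_cons Pi.
rewrite (_ : (fun x => _) = F i * (fun x => \prod_(i <- r | P i) F i x)).
  exact: differentiableM.
by apply/funext => x; rewrite big_cons Pi.
Qed.

Lemma differentiable_entry m n (A : V -> 'M[C]_(m, n)) p i j : differentiable A p ->
  differentiable (fun x => A x i j : C) p.
Proof.
move=> Ad; apply: (@differentiable_comp _ _ _ _ A (fun N : 'M[C]_(m, n) => N i j : C)) => //.
exact: differentiable_coord.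
Qed.

Lemma differentiable_rV n (f : V -> 'rV[C]_n) p :
  (forall j, differentiable (fun x => f x 0 j : C) p) -> differentiable f p.
Proof.
move=> fd; rewrite (_ : f = fun x => \sum_j (f x 0 j) *: delta_mx 0 j).
  by apply: differentiable_bigsum => j; exact: differentiableZl.
by apply/funext => x; exact: row_sum_delta.
Qed.

Lemma differentiable_det n (A : V -> 'M[C]_n) p :
  (forall i j, differentiable (fun x => A x i j : C) p) ->
  differentiable (fun x => \det (A x) : C) p.
Proof.
move=> Ad; apply: differentiable_bigsum => s.
apply: differentiable_mul.
  exact: differentiable_cst.
exact: differentiable_bigprod.
Qed.

Lemma differentiable_adj n (A : V -> 'M[C]_n) p i j :
  (forall i j, differentiable (fun x => A x i j : C) p) ->
  differentiable (fun x => (\adj (A x)) i j : C) p.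
Proof.
move=> Ad.
rewrite (_ : (fun x => _) = (cst ((-1) ^+ (j + i)) : V -> C) *
    (fun x => \det (row' j (col' i (A x))))).
  apply: differentiableM; first exact: differentiable_cst.
  apply: differentiable_det => k l.
  by rewrite (_ : (fun x => _) = (fun x => A x (lift j k) (lift i l)))//;
    apply/funext => x; rewrite !mxE.
by apply/funext => x; rewrite !mxE.
Qed.

End Sums.

Lemma differentiable_mean (V W : normedModType C) (phi : R -> V -> W) p m x h :
  (forall t, differentiable (phi t) p) ->
  differentiable (fun q => mean m (phi ^~ q) x h) p.
Proof.
move=> Hd; elim: m x h => [|m IH] x h /=; first exact: Hd.
apply: (@differentiableZ _ _ _ ((fun q => mean m (phi ^~ q) x (h / 2)) +
   (fun q => mean m (phi ^~ q) (x + h / 2) (h / 2)))).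
exact: differentiableD.
Qed.

Lemma rn_cont_bounded (V W : normedModType C) (f : V -> W) p : {for p, continuous f} ->
  exists2 d : R, 0 < d & forall q, rn (q - p) < d -> rn (f q) <= rn (f p) + 1.
Proof.
move=> /rn_contP/(_ 1 ltr01)[d d0 H]; exists d => // q /H fq.
have -> : f q = f p + (f q - f p) by abelian.
by have := rnD (f p) (f q - f p); lra.
Qed.

(* By Cauchy's formula the directional derivative is a limit of bounded averages
   of translates of [f]. *)
Lemma differentiable_dir_diff (V W : normedModType C) (f : V -> W) (A : set V) (p e : V) :
  scomplete W -> open A -> A p -> (forall q, A q -> differentiable f q) ->
  differentiable (fun q => 'd f q e) p.
Proof.
move=> Wc /rn_openP/[apply] -[d1 d10 dA] fd.
have fp : differentiable f p by apply/fd/dA; rewrite subrr rn0.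
have [d2 d20 fM] := rn_cont_bounded (differentiable_continuous fp).
pose d := Num.min d1 d2; have d0 : 0 < d by rewrite lt_min d10.
have dd q : rn (q - p) < d -> differentiable f q.
  by rewrite lt_min => /andP[/dA/fd].
have dM q : rn (q - p) < d -> rn (f q) <= rn (f p) + 1.
  by rewrite lt_min => /andP[_ /fM].
have e1 : 0 < rn e + 1 by rewrite ltr_wpDl ?rn_ge0.
(* Circles of radius [r] in the direction [e] around points of the half ball then stay inside the
   ball of radius [d]. *)
pose r := d / (4 * (rn e + 1)).
have r0 : 0 < r by rewrite divr_gt0// mulr_gt0.
have re : r * rn e < d / 2.
  have : r * (rn e + 1) = d / 4 by rewrite /r; field; rewrite gt_eqF.
  lra.
have near q t : rn (q - p) < d / 2 -> rn (q + circ r t *: e - p) < d.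
  move=> qp; have -> : q + circ r t *: e - p = (q - p) + circ r t *: e by abelian.
  by apply: le_lt_trans (rnD _ _) _; rewrite rnZ rn_circ//; lra.
pose F m q := mean m (fun t => (circ r t)^-1 *: f (q + circ r t *: e)) 0 1.
have d20' : 0 < d / 2 by lra.
refine (@weierstrass_diff _ _ _ F (fun q => 'd f q e) p (d / 2) ((rn (f p) + 1) / r)
  Wc d20' _ _ _).1.
- move=> k q qp; apply: (@differentiable_mean _ _
    (fun t q => (circ r t)^-1 *: f (q + circ r t *: e))) => t.
  apply: (@differentiableZ _ _ _ (fun q => f (q + circ r t *: e))).
  apply: (@differentiable_comp _ _ _ _ (fun q => q + circ r t *: e) f).
    exact: (@differentiableD _ _ _ id (cst _)).
  by apply: dd; exact: near.
- move=> k q qp; apply: mean_le => // t _.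
  by rewrite rnZ rnV rn_circ// mulrC ler_pM2r ?invr_gt0//; apply: dM; exact: near.
- move=> q qp e' e'0; apply: (cauchy_mean_dir dd) => //; lra.
Qed.

End Differentiability.

(** * The Hamiltonian field in coordinates *)

Section HamiltonianField.
Context {R : realType} {n : nat} (S : hol_ham_system (Cplx R) n).
Local Notation C := (Cplx R).

Let dH (i : atlas S) (p : 'rV[C]_n) (a : 'I_n) : C :=
  'd (ham_fun (h:=S) \o cinv (chart_of i)) p (basis_vec C a).

(** [ham_comp] is only a chosen solution of a linear system; non-degeneracy makes the solution
    unique, so the choice equals an explicit formula that can be differentiated. *)
Lemma ham_compE (i : atlas S) p : ccod (chart_of i) p ->
  ham_comp i p = (\row_a - dH i p a) *m invmx (form_mx (ham_form S) i p).
Proof.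
move=> ip; apply: (ham_vec_inj ip (ham_compP ip)) => v.
rewrite /form_eval mulmxKV ?form_unit// mxE.
rewrite [in RHS](row_sum_delta v) linear_sum -sumrN; apply: eq_bigr => a _.
by rewrite !mxE linearZ /= mulNr mulrC.
Qed.

Lemma ham_comp_differentiable (i : atlas S) p : ccod (chart_of i) p ->
  differentiable (ham_comp (S:=S) i) p.
Proof.
move=> ip; have ci := @ccod_open _ _ _ (chart_of i).
pose Om := form_mx (ham_form S) i.
(* Cramer's formula replaces [invmx], whose definition branches on invertibility, by polynomials in
   the entries and one division. It agrees with [ham_comp] on the open set [ccod]. *)
pose F (q : 'rV[C]_n) : 'rV[C]_n := (\det (Om q))^-1 *: ((\row_a - dH i q a) *m \adj (Om q)).
have Omd k l : differentiable (fun q => Om q k l : C) p.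
  by apply: differentiable_entry; exact: form_holo.
apply: (@differentiable_near_eq _ _ _ F).
  apply: differentiable_scale.
    apply: differentiableV; first exact: differentiable_det.
    by have := form_unit ip; rewrite unitmxE unitfE.
  apply: differentiable_rV => j.
  rewrite (_ : (fun q => _) = (fun q => \sum_a (- dH i q a) * (\adj (Om q)) a j)).
    apply: differentiable_bigsum => a.
    apply: differentiable_mul.
      apply: (@differentiableN _ _ _ (fun q => dH i q a)).
      apply: (differentiable_dir_diff _ _ ci ip); first exact: scomplete_C.
      by move=> q iq; exact: ham_fun_holo.
    exact: differentiable_adj.
  by apply/funext => q; rewrite mxE; apply: eq_bigr => a _; rewrite mxE.
apply/rn_nearP; have [d d0 H] := (rn_openP _).1 ci p ip; exists d => // q /H iq.
by rewrite ham_compE// /invmx form_unit// /F -scalemxAr.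
Qed.

End HamiltonianField.

(** * Euler's method *)

Section DifferentialRules.
Context {R : realType}.
Local Notation C := (Cplx R).

Lemma is_diff_bounded_linear (V W : normedModType C) (L : V -> W) p (K : R) :
  linear L -> (forall v, rn (L v) <= K * rn v) -> is_diff p L L.
Proof.
move=> linL LK; apply: (rn_diff_intro linL LK) => e e0; exists 1 => // v _.
have -> : L (p + v) = L p + L v by have := linL 1 p v; rewrite !scale1r.
rewrite [L p + _]addrC addrK subrr rn0 mulr_ge0 ?rn_ge0//; exact: ltW.
Qed.

Lemma is_diff_scale (V W : normedModType C) (k dk : V -> C) (f df : V -> W) x :
  is_diff x k dk -> is_diff x f df ->
  is_diff x (fun y => k y *: f y) (fun v => k x *: df v + dk v *: f x).
Proof.
move=> [kd kE] [fd fE]; split; first exact: differentiable_scale.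
have bc : continuous (fun q : C * W => q.1 *: q.2) by move=> q; exact: scale_continuous.
have pd : differentiable (fun y => (k y, f y)) x by exact: differentiable_pair.
rewrite (@diff_comp _ _ _ _ (fun y => (k y, f y)) (fun q => q.1 *: q.2)) //; last first.
  exact: (differentiable_bilin _ bc).
rewrite (diff_bilin (f := @GRing.scale C W) _ bc) (diff_pair kd fd) kE fE.
by [].
Qed.

Lemma is_diff_compose (U V W : normedModType C) (f df : U -> V) (g dg : V -> W) x :
  is_diff x f df -> is_diff (f x) g dg -> is_diff x (g \o f) (dg \o df).
Proof.
move=> [fd fE] [gd gE]; split; first exact: differentiable_comp.
by rewrite diff_comp// fE gE.
Qed.

End DifferentialRules.

Section RealRecurrence.
Context {R : realType}.

Lemma perturbed_growth (a : nat -> R) (eta c : R) N :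
  a 0%N = 0 -> 0 <= eta -> 0 <= c -> N%:R * eta <= 1 / 2 ->
  (forall k, (k < N)%N -> a k.+1 <= (1 + eta) * a k + c) ->
  forall k, (k <= N)%N -> a k <= 2 * c * k%:R.
Proof.
move=> a0 eta0 c0 Neta step; elim=> [|k IH] kN; first by rewrite a0 mulr0.
apply: le_trans (step k kN) _; rewrite -natr1.
have ke : k%:R * eta <= 1 / 2.
  by apply: le_trans Neta; rewrite ler_wpM2r// ler_nat ltnW.
have e1 : 0 <= 1 + eta by lra.
have := ler_wpM2l e1 (IH (ltnW kN)); have := ler_wpM2l c0 ke; lra.
Qed.

End RealRecurrence.

(** * Convergence of Euler's polygons to a holomorphic flow *)

Section Euler.
Context {R : realType}.
Local Notation C := (Cplx R).
Context {V : normedModType C}.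
Variables (F : V -> V) (p : V) (rho tau M K K2 : R).
Hypotheses (V_complete : scomplete V) (tau0 : 0 < tau).
Hypotheses (M0 : 0 <= M) (K0 : 0 <= K) (K20 : 0 <= K2).
Hypotheses (tauM : tau * M <= rho / 4) (tauK : tau * K <= 1 / 2).
Hypothesis Fd : forall q, rn (q - p) < rho -> differentiable F q.
Hypothesis FM : forall q, rn (q - p) < rho -> rn (F q) <= M.
Hypothesis FL : forall q q', rn (q - p) < rho -> rn (q' - p) < rho ->
  rn (F q' - F q) <= K * rn (q' - q).
Hypothesis FdK : forall q v, rn (q - p) < rho -> rn ('d F q v) <= K * rn v.
Hypothesis FT : forall q v, rn (q - p) < rho -> rn v <= tau * M ->
  rn (F (q + v) - F q - 'd F q v) <= K2 * rn v ^+ 2.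

Definition euler_step (h : C) (y : V) : V := y + h *: F y.
Definition euler_iter (k : nat) (h : C) (x : V) : V := iter k (euler_step h) x.
(** The number of steps doubles with [m], so consecutive approximations are compared by splitting
    each step in two. *)
Definition euler (m : nat) (t : C) (x : V) : V :=
  euler_iter (2 ^ m) (cR (2^-1 ^+ m) * t) x.

Lemma euler_iterS k (h : C) (x : V) :
  euler_iter k.+1 h x = euler_iter k h x + h *: F (euler_iter k h x).
Proof. by []. Qed.

(** Each step moves by at most [rn h * M], hence all of them by at most [tau * M <= rho / 4]. The
    bound [3 * rho / 4] leaves a margin below [rho], so that the limit, which satisfies only the
    weak inequality, stays in the open ball. *)
Lemma euler_iter_near k (h : C) (x : V) : k%:R * rn h <= tau -> rn (x - p) < rho / 2 ->
  rn (euler_iter k h x - p) < 3 * rho / 4.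
Proof.
move=> kh xp; have h0 := rn_ge0 h.
suff H : rn (euler_iter k h x - x) <= k%:R * rn h * M.
  have -> : euler_iter k h x - p = (euler_iter k h x - x) + (x - p) by abelian.
  have := rnD (euler_iter k h x - x) (x - p).
  have := ler_wpM2r M0 kh; have := tauM; lra.
elim: k kh => [|k IH] kh; first by rewrite /= subrr rn0 !mul0r.
have kh' : k%:R * rn h <= tau by rewrite -natr1 mulrDl mul1r in kh; lra.
have := IH kh'; set y := euler_iter k h x => yx.
have yp : rn (y - p) < rho.
  have -> : y - p = (y - x) + (x - p) by abelian.
  have := rnD (y - x) (x - p).
  have := ler_wpM2r M0 kh'; have := tauM; have := rn_ge0 (x - p); lra.
rewrite euler_iterS -/y -natr1 2!mulrDl mul1r.
have -> : y + h *: F y - x = (y - x) + h *: F y by abelian.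
apply: le_trans (rnD _ _) _; rewrite rnZ; apply: lerD => //.
by rewrite ler_wpM2l// FM.
Qed.

Lemma euler_iter_in k (h : C) (x : V) : k%:R * rn h <= tau -> rn (x - p) < rho / 2 ->
  rn (euler_iter k h x - p) < rho.
Proof.
move=> kh xp; have := euler_iter_near kh xp.
by have := rn_ge0 (euler_iter k h x - p); lra.
Qed.

(** Two half steps differ from one full step by the Lipschitz effect of the earlier gap, a factor
    [1 + rn h * K], and by re-evaluating [F] after half a step, at most [K * M * rn h ^+ 2 / 4]. For
    [N = 2 ^ m] and [h = t / 2 ^ m] the resulting bound is geometric in [m]. *)
Lemma euler_iter_double N (h : C) (x : V) : N%:R * rn h <= tau -> rn (x - p) < rho / 2 ->
  rn (euler_iter N.*2 (cR 2^-1 * h) x - euler_iter N h x)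
    <= K * M * rn h ^+ 2 * N%:R.
Proof.
move=> Nh xp; have h0 := rn_ge0 h.
pose h2 := cR 2^-1 * h.
have h2E : rn h2 = rn h / 2 by rewrite rnM rn_cR ger0_norm ?invr_ge0// mulrC.
pose a k := rn (euler_iter k.*2 h2 x - euler_iter k h x).
pose c := K * M * rn h ^+ 2 / 4.
have c0 : 0 <= c by rewrite divr_ge0// !mulr_ge0// sqr_ge0.
have aN : a N <= 2 * c * N%:R.
  apply: (@perturbed_growth _ a (rn h * K) c N) => //.
  - by rewrite /a /= subrr rn0.
  - exact: mulr_ge0.
  - by rewrite mulrA; apply: le_trans tauK; rewrite ler_wpM2r.
  move=> k kN; rewrite /a doubleS /=.
  set z := euler_iter k.*2 h2 x; set y := euler_iter k h x.
  have k1h : k.+1%:R * rn h <= tau by apply: le_trans Nh; rewrite ler_wpM2r// ler_nat.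
  have kh : k%:R * rn h <= tau by apply: le_trans k1h; rewrite ler_wpM2r// ler_nat.
  have yp : rn (y - p) < rho by exact: euler_iter_in.
  have zp : rn (z - p) < rho.
    by apply: euler_iter_in => //; rewrite h2E -muln2 natrM; lra.
  have zp' : rn (euler_step h2 z - p) < rho.
    apply: (@euler_iter_in k.*2.+1) => //; rewrite h2E -muln2 -natr1 natrM.
    by move: k1h; rewrite -natr1; lra.
  rewrite -/(euler_iter _ _ _) -/z -/y {1}/euler_step.
  have hh : h = h2 + h2.
    have E : 2^-1 + 2^-1 = 1 :> R by lra.
    by rewrite /h2 -mulrDl -cRD E mul1r.
  have -> : euler_step h2 z + h2 *: F (euler_step h2 z) - euler_step h y =
    (z - y) + h *: (F z - F y) + h2 *: (F (euler_step h2 z) - F z).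
    move: (F (euler_step h2 z)) => e; rewrite /euler_step hh !scalerDl !scalerBr.
    by set u := h2 *: F z; set v := h2 *: F y; set w := h2 *: e; abelian.
  apply: le_trans (rnD _ _) _; apply: lerD.
    apply: le_trans (rnD _ _) _; rewrite mulrDl mul1r lerD2l rnZ -mulrA ler_wpM2l//.
    exact: FL.
  rewrite rnZ h2E; apply: le_trans (ler_wpM2l _ (FL zp zp')) _; first by rewrite divr_ge0.
  have -> : euler_step h2 z - z = h2 *: F z by rewrite /euler_step; abelian.
  rewrite rnZ h2E /c.
  have : K * (rn h / 2 * rn (F z)) <= K * (rn h / 2 * M).
    by rewrite !ler_wpM2l// ?divr_ge0// FM.
  move=> /(ler_wpM2l h0); lra.
rewrite -/h2; apply: le_trans aN _; rewrite ler_wpM2r//.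
rewrite /c; have := c0; rewrite /c; lra.
Qed.

Lemma scauchy_geometric (W : normedModType C) (u : nat -> W) (D : R) : 0 <= D ->
  (forall m, rn (u m.+1 - u m) <= D * 2^-1 ^+ m) -> scauchy u.
Proof.
move=> D0 uD.
have pos m : 0 < 2^-1 ^+ m :> R by rewrite exprn_gt0.
have tail m k : rn (u (m + k)%N - u m) <= 2 * D * (2^-1 ^+ m - 2^-1 ^+ (m + k)).
  elim: k => [|k IH]; first by rewrite addn0 !subrr rn0 mulr0.
  rewrite addnS; apply: le_trans (rn_tri (u (m + k)%N) _ _) _.
  have := uD (m + k)%N; have : 2^-1 ^+ (m + k).+1 = 2^-1 ^+ (m + k) / 2 :> R by rewrite exprS mulrC.
  move=> ->; lra.
have tail' N m : (N <= m)%N -> rn (u m - u N) <= 2 * D * 2^-1 ^+ N.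
  move=> /subnKC <-; apply: le_trans (tail _ _) _.
  by rewrite ler_wpM2l ?mulr_ge0// gerBl ltW.
move=> e e0.
have D4 : 0 < 4 * D + 1 by rewrite ltr_wpDl// mulr_ge0.
have [N /(_ N (leqnn N)) NP] := half_expr_small (divr_gt0 e0 D4).
exists N => j k Nj Nk; apply: le_trans (rn_tri (u N) _ _) _.
rewrite [rn (u N - u k)]rnC.
have := tail' _ _ Nj; have := tail' _ _ Nk; move: NP; rewrite ltr_pdivlMr//.
have := pos N; lra.
Qed.

Lemma euler_stepsize m (t : C) k : rn t < tau -> (k <= 2 ^ m)%N ->
  k%:R * rn (cR (2^-1 ^+ m) * t) <= tau.
Proof.
move=> tt km; rewrite rnM rn_cR ger0_norm ?exprn_ge0 ?invr_ge0// mulrA.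
have E : (2 ^ m)%:R * 2^-1 ^+ m = 1 :> R by rewrite natrX -exprMn divff// expr1n.
have : k%:R * 2^-1 ^+ m <= 1 :> R.
  by rewrite -[leRHS]E ler_wpM2r ?exprn_ge0 ?invr_ge0// ler_nat.
have := rn_ge0 t; nra.
Qed.

Lemma euler_near m (t : C) x : rn t < tau -> rn (x - p) < rho / 2 ->
  rn (euler m t x - p) < 3 * rho / 4.
Proof. by move=> tt xp; apply: euler_iter_near => //; exact: euler_stepsize. Qed.

Lemma euler_cvg (t : C) x : rn t < tau -> rn (x - p) < rho / 2 ->
  exists l, slim (fun m => euler m t x) l.
Proof.
move=> tt xp; apply: V_complete.
have D0 : 0 <= K * M * rn t ^+ 2 by rewrite !mulr_ge0 ?rn_ge0.
apply: (scauchy_geometric D0) => m.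
pose h := cR (2^-1 ^+ m) * t.
have := euler_iter_double (euler_stepsize tt (leqnn (2 ^ m))) xp.
have -> : cR 2^-1 * (cR (2^-1 ^+ m) * t) = cR (2^-1 ^+ m.+1) * t.
  by rewrite mulrA -cRM -exprS.
rewrite -mul2n -expnS => /le_trans; apply.
rewrite rnM rn_cR ger0_norm ?exprn_ge0 ?invr_ge0//.
have E : (2 ^ m)%:R * 2^-1 ^+ m = 1 :> R by rewrite natrX -exprMn divff// expr1n.
rewrite le_eqVlt; apply/orP; left; apply/eqP.
rewrite exprMn [(2^-1 ^+ m) ^+ 2]expr2.
transitivity (K * M * rn t ^+ 2 * 2^-1 ^+ m * ((2 ^ m)%:R * 2^-1 ^+ m)); first by ring.
by rewrite E mulr1.
Qed.

(* The derivative of [euler_iter k (cR c * t) x] in the direction of [t]. At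
   [k = c^-1] it is close to the value of [F] at the endpoint, which makes the
   limit of the polygons a solution. *)
Fixpoint euler_velocity (c : R) (t : C) (x : V) (k : nat) : V :=
  if k is j.+1 then
    let y := euler_iter j (cR c * t) x in let d := euler_velocity c t x j in
    d + cR c *: F y + (cR c * t) *: 'd F y d
  else 0.

(** The chain and product rules applied to one more step [y + (c t) *: F y]. Of the differential in
    [(t, x)] only the value on [(1, 0)], the time derivative, is recorded. *)
Lemma is_diff_euler_iter (c : R) (t : C) x k : k%:R * rn (cR c * t) <= tau ->
  rn (x - p) < rho / 2 ->
  exists2 L, is_diff (t, x) (fun q : C * V => euler_iter k (cR c * q.1) q.2) L &
    L (1, 0) = euler_velocity c t x k.
Proof.
move=> + xp; elim: k => [|k IH] kt.
  exists (fun v : C * V => v.2) => //=.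
  apply: (@is_diff_bounded_linear _ _ _ _ _ 1) => // v.
  by rewrite mul1r rn_pair le_max lexx orbT.
have ktau : k%:R * rn (cR c * t) <= tau.
  by apply: le_trans kt; rewrite ler_wpM2r ?rn_ge0// ler_nat.
have [L Ld LE] := IH ktau.
have yp := euler_iter_in ktau xp; set y := euler_iter k (cR c * t) x in yp.
have Fy : is_diff y F ('d F y) by apply: differentiableP; exact: Fd.
have FLd := is_diff_compose Ld Fy.
have hd : is_diff (t, x) (fun q : C * V => cR c * q.1 : C) (fun v : C * V => cR c * v.1 : C).
  apply: (@is_diff_bounded_linear _ _ _ _ _ `|c|) => [a u v|v].
    by rewrite /= mulrDr /GRing.scale /= mulrCA.
  by rewrite rnM rn_cR ler_wpM2l// rn_pair le_max lexx.
exists (L + (fun v : C * V => (cR c * t) *: 'd F y (L v) + (cR c * v.1) *: F y)).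
  exact: (is_diffD Ld (is_diff_scale hd FLd)).
by rewrite fctE /= LE mulr1 -/y -addrA [X in _ + X]addrC.
Qed.

(* [euler_velocity k - (k c) F y_k] satisfies a recurrence with defect O(c^2). *)
Lemma euler_velocity_defect m (t : C) x : rn t < tau -> rn (x - p) < rho / 2 ->
  rn (euler_velocity (2^-1 ^+ m) t x (2 ^ m) - F (euler m t x))
    <= 2 * (K2 * (tau * M) ^+ 2 + K * tau * M) * 2^-1 ^+ m.
Proof.
move=> tt xp; pose c : R := 2^-1 ^+ m; pose h := cR c * t; pose N := (2 ^ m)%N.
have c0 : 0 <= c by rewrite exprn_ge0 ?invr_ge0.
have E : N%:R * c = 1 :> R by rewrite natrX -exprMn divff// expr1n.
have h0 := rn_ge0 h.
have hE : rn h = c * rn t by rewrite rnM rn_cR ger0_norm.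
have htau : rn h <= c * tau by rewrite hE ler_wpM2l// ltW.
have Nh : N%:R * rn h <= tau by exact: euler_stepsize.
pose y k := euler_iter k h x; pose v k := euler_velocity c t x k.
pose a k := rn (v k - (cR (k%:R * c)) *: F (y k)).
pose D := K2 * (tau * M) ^+ 2 + K * tau * M.
have D0 : 0 <= D by rewrite addr_ge0// !mulr_ge0 ?sqr_ge0// ltW.
have cD0 : 0 <= c ^+ 2 * D by rewrite mulr_ge0 ?sqr_ge0.
have c1 : c <= 1 by rewrite exprn_ile1// ?invr_ge0// invf_le1// ler1n.
have -> : rn (euler_velocity (2^-1 ^+ m) t x (2 ^ m) - F (euler m t x)) = a N.
  by rewrite /a E cR1 scale1r.
have -> : 2 * (K2 * (tau * M) ^+ 2 + K * tau * M) * 2^-1 ^+ m = 2 * (c ^+ 2 * D) * N%:R.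
  by rewrite -/D -/c; transitivity (2 * D * c * (N%:R * c)); [rewrite E mulr1|ring].
apply: (@perturbed_growth _ a (rn h * K) _ N) => //.
- by rewrite /a /= mul0r cR0 scale0r subrr rn0.
- exact: mulr_ge0.
- by rewrite mulrA; apply: le_trans tauK; rewrite ler_wpM2r.
move=> k kN.
have -> : a k.+1 = rn (v k + cR c *: F (y k) + h *: 'd F (y k) (v k)
  - cR (k.+1%:R * c) *: F (y k + h *: F (y k))) by [].
rewrite /a.
have kh : k%:R * rn h <= tau by apply: le_trans Nh; rewrite ler_wpM2r// ler_nat ltnW.
have yp : rn (y k - p) < rho by exact: euler_iter_in.
set Y := y k in yp *; set d := v k.
have FY := FM yp.
have hFY : rn (h *: F Y) <= c * (tau * M).
  by rewrite rnZ mulrA ler_pM// rn_ge0.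
have hFY' : rn (h *: F Y) <= tau * M.
  by apply: le_trans hFY _; have := mulr_ge0 (ltW tau0) M0; nra.
have T := FT yp hFY'.
have dFh : rn ('d F Y (h *: F Y)) <= K * (c * (tau * M)).
  by apply: le_trans (FdK _ yp) _; rewrite ler_wpM2l.
have dFd := FdK (d - cR (k%:R * c) *: F Y) yp.
(* Splits the image of the velocity into that of its defect, which feeds the recurrence, and that of
   its expected value, which meets the Taylor expansion of [F] at the next vertex. *)
have lin (L : {linear V -> V}) (b : C) u w : h *: L u = h *: L (u - b *: w) + b *: L (h *: w).
  have -> : L (u - b *: w) = L u - b *: L w by rewrite linearB linearZ_LR.
  have -> : L (h *: w) = h *: L w by rewrite linearZ_LR.
  by rewrite scalerBr 2!scalerA (mulrC b) subrK.
rewrite (lin ('d F Y) (cR (k%:R * c)) d (F Y)).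
move: ('d F Y (d - cR (k%:R * c) *: F Y)) dFd => U dFd.
move: ('d F Y (h *: F Y)) T dFh => Z T dFh.
move: (F (Y + h *: F Y)) T => F1 T.
have kc : cR (k.+1%:R * c) = cR (k%:R * c) + cR c by rewrite -cRD -natr1 mulrDl mul1r.
(* The new defect is the old one, its image under [h 'd F], a Taylor remainder of [F] weighted by at
   most [1], and a leftover of weight [c]. The last two are together at most [c ^+ 2 * D]. *)
have regroup (b b' : C) (g f u z f1 : V) : g + b' *: f + (u + b *: z) - (b + b') *: f1 =
    (g - b *: f) + u - (b + b') *: (f1 - f - z) - b' *: z.
  by rewrite !scalerDl !scalerBr; abelian.
rewrite kc regroup -kc.
apply: le_trans (rnB _ _) _; apply: le_trans (lerD (rnB _ _) (lexx _)) _.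
apply: le_trans (lerD (lerD (rnD _ _) (lexx _)) (lexx _)) _.
rewrite !rnZ !rn_cR !ger0_norm ?mulr_ge0//.
have k1 : k.+1%:R * c <= 1 by rewrite -[leRHS]E ler_wpM2r// ler_nat.
have T' : k.+1%:R * c * rn (F1 - F Y - Z) <= K2 * (c * (tau * M)) ^+ 2.
  apply: le_trans (_ : 1 * rn (F1 - F Y - Z) <= _).
    by rewrite ler_wpM2r ?rn_ge0.
  rewrite mul1r; apply: le_trans T _; rewrite ler_wpM2l//.
  by rewrite lerXn2r ?nnegrE ?rn_ge0// !mulr_ge0// ltW.
have Z' : c * rn Z <= c * (K * (c * (tau * M))) by rewrite ler_wpM2l.
have U' := ler_wpM2l h0 dFd.
rewrite hE in U'; rewrite /D; lra.
Qed.

Lemma slim_vanish (W : normedModType C) (u : nat -> W) (l : W) (D : R) :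
  (forall m, rn (u m - l) <= D * 2^-1 ^+ m) -> slim u l.
Proof.
move=> uD e e0.
have D1 : 0 < `|D| + 1 by rewrite ltr_wpDl.
have [N NH] := half_expr_small (divr_gt0 e0 D1); exists N => m /NH.
rewrite ltr_pdivlMr// => H; apply: le_trans (uD m) _; apply: le_trans (ltW H).
rewrite mulrC ler_wpM2l ?exprn_ge0 ?invr_ge0//.
by apply: le_trans (ler_norm D) _; rewrite lerDl.
Qed.

(** The theorem on limits, applied on [C * V], gives joint holomorphy and convergence of the time
    derivatives. By [euler_velocity_defect] these have the same limit as [F] along the polygons'
    endpoints, which is [F (phi t x)] since [F] is Lipschitz. *)
Lemma euler_flow : exists phi : C -> V -> V, forall t x,
  rn t < tau -> rn (x - p) < rho / 2 ->
  [/\ rn (phi t x - p) < rho,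
      phi 0 x = x,
      differentiable (fun q : C * V => phi q.1 q.2) (t, x) &
      'd (fun q : C * V => phi q.1 q.2) (t, x) (1, 0) = F (phi t x)].
Proof.
have /choice[f fP] (q : C * V) : exists l, rn q.1 < tau -> rn (q.2 - p) < rho / 2 ->
    slim (fun m => euler m q.1 q.2) l.
  have [[q1 q2]|nq] := pselect (rn q.1 < tau /\ rn (q.2 - p) < rho / 2); last first.
    by exists 0 => q1 q2; case: nq.
  by have [l lP] := euler_cvg q1 q2; exists l.
exists (fun t x => f (t, x)) => t x tt xp.
have fp : rn (f (t, x) - p) <= 3 * rho / 4.
  apply: slim_le (slimB (fP (t, x) tt xp) (slim_cst p)) _ => m.
  by apply: ltW; exact: euler_near.
have fp' : rn (f (t, x) - p) < rho by have := rn_ge0 (x - p); lra.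
pose r := Num.min (tau - rn t) (rho / 2 - rn (x - p)).
have r0 : 0 < r by rewrite lt_min !subr_gt0 tt.
have inr (q : C * V) : rn (q - (t, x)) < r -> rn q.1 < tau /\ rn (q.2 - p) < rho / 2.
  rewrite rn_pair lt_min !gt_max => /andP[/andP[h1 _] /andP[_ h2]]; split.
    have -> : q.1 = (q.1 - t) + t by abelian.
    by apply: le_lt_trans (rnD _ _) _; move: h1; rewrite ltrBrDr.
  have -> : q.2 - p = (q.2 - x) + (x - p) by abelian.
  by apply: le_lt_trans (rnD _ _) _; move: h2; rewrite ltrBrDr.
have Ed m (q : C * V) : rn (q - (t, x)) < r ->
    differentiable (fun q : C * V => euler m q.1 q.2) q.
  move=> /inr; case: q => s y /= [st yp].
  by have [L [Ld _] _] := is_diff_euler_iter (euler_stepsize st (leqnn (2 ^ m))) yp.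
have EM m (q : C * V) : rn (q - (t, x)) < r -> rn (euler m q.1 q.2) <= rho + rn p.
  move=> /inr[q1 q2]; have -> : euler m q.1 q.2 = (euler m q.1 q.2 - p) + p by abelian.
  apply: le_trans (rnD _ _) _; rewrite lerD2r; apply: ltW.
  by apply: euler_iter_in => //; exact: euler_stepsize.
have Elim (q : C * V) : rn (q - (t, x)) < r -> slim (fun m => euler m q.1 q.2) (f (q.1, q.2)).
  by move=> /inr[q1 q2]; case: q q1 q2 => s y q1 q2; exact: fP.
have [fd flim] := @weierstrass_diff _ _ _ (fun m q => euler m q.1 q.2)
  (fun q => f (q.1, q.2)) (t, x) r (rho + rn p) V_complete r0 Ed EM Elim.
split=> //.
  apply: slim_unique (fP (0, x) _ xp) _; first by rewrite /= rn0.
  apply: slim_eq (slim_cst x) _ => m.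
  rewrite /euler /= mulr0; elim: (2 ^ m)%N => //= k <-.
  by rewrite /euler_step scale0r addr0.
apply: slim_unique (flim (1, 0)) _.
have FE : slim (fun m => F (euler m t x)) (F (f (t, x))).
  move=> e e0; have K1 : 0 < K + 1 by rewrite ltr_wpDl.
  have [N NP] := fP (t, x) tt xp _ (divr_gt0 e0 K1); exists N => m /NP.
  rewrite ler_pdivlMr//= => H.
  have ep : rn (euler m t x - p) < rho by apply: euler_iter_in => //; exact: euler_stepsize.
  apply: le_trans (FL fp' ep) _; apply: le_trans H.
  by rewrite mulrC ler_wpM2l ?rn_ge0// lerDl.
have vE : slim (fun m => euler_velocity (2^-1 ^+ m) t x (2 ^ m) - F (euler m t x)) 0.
  by apply: slim_vanish => m; rewrite subr0; exact: euler_velocity_defect.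
apply: slim_eq_lim (slim_eq (slimD vE FE) _) (add0r _) => m.
rewrite subrK.
have [L [_ LE] <-] := is_diff_euler_iter (euler_stepsize tt (leqnn (2 ^ m))) xp.
by have := congr1 (fun h : C * V -> V => h (1, 0)) LE => /esym.
Qed.

End Euler.

(** * Holomorphic ordinary differential equations *)

Section HolomorphicODE.
Context {R : realType}.
Local Notation C := (Cplx R).

Section Lipschitz.
Context {V W : normedModType C}.
Variables (f : V -> W) (p : V) (rho M : R).
Hypothesis rho0 : 0 < rho.
Hypothesis fd : forall q, rn (q - p) < rho -> differentiable f q.
Hypothesis fM : forall q, rn (q - p) < rho -> rn (f q) <= M.

Lemma cauchy_lipschitz_diff q v : rn (q - p) < rho / 2 ->
  rn ('d f q v) <= 4 * M / rho * rn v.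
Proof.
move=> qp; have [->|] := eqVneq v 0; first by rewrite linear0 !rn0 mulr0.
rewrite -rn_gt0 => v0.
have -> : 4 * M / rho * rn v = M / (rho / (4 * rn v)).
  by field; have := rho0; rewrite !gt_eqF.
apply: (cauchy_estimate fd fM); first by rewrite divr_gt0// mulr_gt0.
have -> : rho / (4 * rn v) * rn v = rho / 4 by field; rewrite gt_eqF.
by have := rho0; lra.
Qed.

Lemma cauchy_lipschitz q q' : rn (q - p) < rho / 2 -> rn (q' - p) < rho / 2 ->
  rn (f q' - f q) <= 4 * M / rho * rn (q' - q).
Proof.
move=> qp qp'; have -> : f q' = f (q + (q' - q)) by congr f; abelian.
apply: mean_value_ineq => t t01.
have near : rn (q + cR t *: (q' - q) - p) < rho / 2.
  have -> : q + cR t *: (q' - q) - p = cR (1 - t) *: (q - p) + cR t *: (q' - p).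
    by rewrite cRB cR1 !scalerBr !scalerBl !scale1r; abelian.
  apply: le_lt_trans (rnD _ _) _; rewrite !rnZ !rn_cR !ger0_norm; [|lra..].
  have [->|t0] := eqVneq t 0; first by rewrite subr0 mul1r mul0r addr0.
  have t0' : 0 < t by rewrite lt_def t0; lra.
  have : t * rn (q' - p) < t * (rho / 2) by rewrite ltr_pM2l.
  have : (1 - t) * rn (q - p) <= (1 - t) * (rho / 2) by apply: ler_wpM2l; [lra|exact: ltW].
  lra.
split; last exact: cauchy_lipschitz_diff.
by apply: fd; have := rho0; lra.
Qed.

End Lipschitz.

Lemma holomorphic_bounded_ball (V W : normedModType C) (f : V -> W) (A : set V) p :
  open A -> A p -> (forall q, A q -> differentiable f q) ->
  exists2 d : R, 0 < d & forall q, rn (q - p) < d -> A q /\ rn (f q) <= rn (f p) + 1.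
Proof.
move=> /rn_openP/[apply] -[d1 d10 dA] fd.
have fp : differentiable f p by apply/fd/dA; rewrite subrr rn0.
have [d2 d20 fM] := rn_cont_bounded (differentiable_continuous fp).
exists (Num.min d1 d2); first by rewrite lt_min d10.
by move=> q; rewrite lt_min => /andP[/dA ? /fM].
Qed.

Section Flow.
Context {V : normedModType C}.
Variables (F : V -> V) (A : set V) (p : V).
Hypotheses (A_open : open A) (Ap : A p).
Hypothesis Fd : forall q, A q -> differentiable F q.

Lemma local_flow : scomplete V -> exists (tau sigma : R) (phi : C -> V -> V),
  [/\ 0 < tau, 0 < sigma & forall t x, rn t < tau -> rn (x - p) < sigma ->
    [/\ A (phi t x),
        phi 0 x = x,
        differentiable (fun q : C * V => phi q.1 q.2) (t, x) &
        'd (fun q : C * V => phi q.1 q.2) (t, x) (1, 0) = F (phi t x)]].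
Proof.
move=> Vc; have [d d0 dA] := holomorphic_bounded_ball A_open Ap Fd.
pose M := rn (F p) + 1; have M0 : 0 < M by rewrite ltr_wpDl ?rn_ge0.
have dd q : rn (q - p) < d -> differentiable F q by move=> /dA[/Fd].
have dM q : rn (q - p) < d -> rn (F q) <= M by move=> /dA[].
(* This choice makes three constraints equalities: [tau * M] is a quarter of the radius [d / 2], it
   is the range [d / 8] of the Taylor bound, and [tau] times the Lipschitz constant [4 * M / d] is
   [1 / 2]. Euler's method runs on the half ball, where the Cauchy estimates from the whole ball
   hold. *)
pose tau := d / (8 * M).
have tau0 : 0 < tau by rewrite divr_gt0// mulr_gt0.
have tauM : tau * M = d / 8 by rewrite /tau; field; rewrite gt_eqF.
have lt_half q : rn (q - p) < d / 2 -> rn (q - p) < d by lra.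
have K0 : 0 <= 4 * M / d by rewrite divr_ge0 ?mulr_ge0// ltW.
have K20 : 0 <= 64 * M / d ^+ 2 by rewrite divr_ge0 ?mulr_ge0 ?sqr_ge0// ltW.
have tauK : tau * (4 * M / d) <= 1 / 2.
  rewrite le_eqVlt; apply/orP; left; apply/eqP.
  by rewrite /tau; field; rewrite !gt_eqF.
have tauM' : tau * M <= d / 2 / 4 by lra.
have T q v : rn (q - p) < d / 2 -> rn v <= tau * M ->
    rn (F (q + v) - F q - 'd F q v) <= 64 * M / d ^+ 2 * rn v ^+ 2.
  move=> qp vM; apply: (taylor_quadratic dd dM) => //; first exact: ltW.
  by rewrite -tauM.
have [phi phiP] := @euler_flow _ _ F p (d / 2) tau M (4 * M / d) (64 * M / d ^+ 2)
  Vc tau0 (ltW M0) K0 K20 tauM' tauK (fun q h => dd q (lt_half q h))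
  (fun q h => dM q (lt_half q h)) (cauchy_lipschitz d0 dd dM)
  (cauchy_lipschitz_diff d0 dd dM) T.
exists tau, (d / 2 / 2), phi; split => //; first by lra.
move=> t x tt xp; have [? ? ? ?] := phiP t x tt xp; split=> //.
by have [] := dA (phi t x); first exact: lt_half.
Qed.

Lemma ode_unique (z0 : C) (y1 y2 : C -> V) : y1 z0 = p -> y2 z0 = p ->
  (\forall z \near z0, differentiable y1 z /\ 'd y1 z 1 = F (y1 z)) ->
  (\forall z \near z0, differentiable y2 z /\ 'd y2 z 1 = F (y2 z)) ->
  \forall z \near z0, y1 z = y2 z.
Proof.
move=> y1p y2p /rn_nearP[d1 d10 H1] /rn_nearP[d2 d20 H2].
have [d d0 dA] := holomorphic_bounded_ball A_open Ap Fd.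
pose M := rn (F p) + 1; have M0 : 0 < M by rewrite ltr_wpDl ?rn_ge0.
have dd q : rn (q - p) < d -> differentiable F q by move=> /dA[/Fd].
have dM q : rn (q - p) < d -> rn (F q) <= M by move=> /dA[].
pose K := 4 * M / d; have K0 : 0 < K by rewrite divr_gt0 ?mulr_gt0.
have FL := cauchy_lipschitz d0 dd dM.
have d20' : 0 < d / 2 by lra.
have y1c : {for z0, continuous y1}.
  by apply: differentiable_continuous; have [] := H1 z0; rewrite ?subrr ?rn0.
have y2c : {for z0, continuous y2}.
  by apply: differentiable_continuous; have [] := H2 z0; rewrite ?subrr ?rn0.
have [d3 d30 H3] := (rn_contP _ _).1 y1c _ d20'.
have [d4 d40 H4] := (rn_contP _ _).1 y2c _ d20'.
rewrite y1p in H3; rewrite y2p in H4.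
pose r := Num.min (Num.min (Num.min d1 d2) (Num.min d3 d4)) (1 / (2 * K)).
have r0 : 0 < r by rewrite !lt_min d10 d20 d30 d40 divr_gt0// mulr_gt0.
have rK : r * K <= 1 / 2.
  apply: le_trans (_ : 1 / (2 * K) * K <= _).
    by rewrite ler_wpM2r ?(ltW K0)// ge_min lexx orbT.
  by rewrite le_eqVlt; apply/orP; left; apply/eqP; field; rewrite gt_eqF.
apply/rn_nearP; exists r => // z zr.
(* On this ball the mean value inequality halves any bound on [y1 - y2]. *)
suff H k : forall z, rn (z - z0) < r -> rn (y1 z - y2 z) <= d * 2^-1 ^+ k.
  apply/eqP; rewrite -subr_eq0; apply/eqP.
  apply: (slim_unique (slim_cst _)); apply: (@slim_vanish _ _ _ _ d) => k.
  by rewrite subr0; exact: H.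
have in_r (w : C) : rn (w - z0) < r -> [/\ differentiable y1 w /\ 'd y1 w 1 = F (y1 w),
    differentiable y2 w /\ 'd y2 w 1 = F (y2 w), rn (y1 w - p) < d / 2 & rn (y2 w - p) < d / 2].
  by rewrite !lt_min => /andP[/andP[/andP[/H1 ? /H2 ?] /andP[/H3 ? /H4 ?]] _].
elim: k => [|k IH] w wr.
  have [_ _ h1 h2] := in_r w wr; rewrite expr0 mulr1.
  have -> : y1 w - y2 w = (y1 w - p) - (y2 w - p) by abelian.
  by have := rnB (y1 w - p) (y2 w - p); lra.
pose e w := y1 w - y2 w.
have e0 : e z0 = 0 by rewrite /e y1p y2p subrr.
have -> : y1 w - y2 w = e (z0 + (w - z0)) - e z0.
  by rewrite e0 subr0; congr e; abelian.
apply: mean_value_ineq => t t01.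
have tw : rn (z0 + cR t *: (w - z0) - z0) < r.
  have -> : z0 + cR t *: (w - z0) - z0 = cR t *: (w - z0) by abelian.
  apply: le_lt_trans wr; rewrite rnZ rn_cR ger0_norm; last lra.
  by rewrite ler_piMl ?rn_ge0//; lra.
set u : C := z0 + cR t *: (w - z0) in tw *.
have [[u1 u1E] [u2 u2E] h1 h2] := in_r u tw.
split; first exact: differentiableB.
have eE : 'd e u (w - z0) = (w - z0) *: (F (y1 u) - F (y2 u)).
  have eB : 'd e u (w - z0) = 'd y1 u (w - z0) - 'd y2 u (w - z0).
    exact: (congr1 (fun h : C -> V => h (w - z0)) (diffB u1 u2)).
  have eB_lin (L1 L2 : {linear C -> V}) (a b : V) : L1 1 = a -> L2 1 = b ->
      L1 (w - z0) - L2 (w - z0) = (w - z0) *: (a - b).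
    have dZ (L : {linear C -> V}) : L (w - z0) = (w - z0) *: L 1.
      by rewrite -linearZ_LR /GRing.scale /= mulr1.
    by move=> <- <-; rewrite (dZ L1) (dZ L2) scalerBr.
  exact: (etrans eB (eB_lin _ _ _ _ u1E u2E)).
rewrite eE rnZ.
have Fu := FL (y2 u) (y1 u) h2 h1.
have IHu := IH u tw.
have wr' : rn (w - z0) <= r by exact: ltW.
apply: le_trans (ler_pM (rn_ge0 _) (rn_ge0 _) wr' Fu) _.
apply: le_trans (_ : r * (K * (d * 2^-1 ^+ k)) <= _).
  by apply: ler_wpM2l; [exact: ltW|apply: ler_wpM2l => //; exact: ltW].
rewrite mulrA exprS.
have p0 : 0 <= d * 2^-1 ^+ k by rewrite mulr_ge0 ?exprn_ge0 ?invr_ge0// ltW.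
have := ler_wpM2r p0 rK; lra.
Qed.

End Flow.
End HolomorphicODE.

(** * Trajectories on the manifold *)

(** The ball is the union of the segments joining its centre to its points, each the continuous
    image of a real interval. *)
Lemma connected_rn_ball (R : realType) (V : normedModType (Cplx R)) (c : V) (r : R) :
  connected [set z | rn (z - c) < r].
Proof.
have [r0|r0] := ltP 0 r; last first.
  rewrite (_ : [set _ | _] = set0); first exact: connected0.
  by apply/seteqP; split=> // z /=; have := rn_ge0 (z - c); lra.
pose seg (z : V) (t : R) : V := c + cR t *: (z - c).
have seg_cont (z : V) : continuous (seg z).
  move=> t A /rn_nearP[e e0 eA].
  have z1 : 0 < rn (z - c) + 1 by rewrite ltr_wpDl ?rn_ge0.
  apply/nbhs_ballP; exists (e / (rn (z - c) + 1)); first by rewrite /= divr_gt0.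
  move=> s; rewrite -ball_normE /= ltr_pdivlMr// => ts; apply: eA.
  have -> : seg z s - seg z t = cR (s - t) *: (z - c).
    by rewrite /seg cRB scalerBl; abelian.
  rewrite rnZ rn_cR distrC; apply: le_lt_trans ts.
  by rewrite ler_wpM2l// lerDl.
rewrite (_ : [set _ | _] = \bigcup_(z in [set z | rn (z - c) < r]) (seg z @` `[0, 1])).
  apply: bigcup_connected.
    by exists c => z _; exists 0; rewrite /= ?in_itv /= ?lexx ?ler01// /seg cR0 scale0r addr0.
  move=> z _; apply: connected_continuous_connected; first exact: segment_connected.
  by apply: continuous_subspaceT; exact: seg_cont.
apply/seteqP; split => [z zr|w [z /= zr [t]]].
  exists z => //; exists 1; rewrite /= ?in_itv /= ?lexx ?ler01//.
  by rewrite /seg cR1 scale1r; abelian.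
rewrite in_itv /= => t01 <-.
have -> : seg z t - c = cR t *: (z - c) by rewrite /seg; abelian.
rewrite rnZ rn_cR ger0_norm; last lra.
by apply: le_lt_trans zr; rewrite ler_piMl ?rn_ge0//; lra.
Qed.

(** * From one chart to the manifold *)

Section Trajectories.
Context {R : realType} {n : nat} (S : hol_ham_system (Cplx R) n).
Local Notation C := (Cplx R).

(** A map built in one chart becomes holomorphic into the manifold: in any other chart it is
    followed by a holomorphic transition. *)
Lemma differentiable_cinv (V : normedModType C) (i j : atlas S) (g : V -> 'rV[C]_n) v :
  differentiable g v -> ccod (chart_of i) (g v) ->
  {for v, continuous (cinv (chart_of i) \o g)} /\
  (cdom (chart_of j) (cinv (chart_of i) (g v)) ->
   differentiable (cmap (chart_of j) \o (cinv (chart_of i) \o g)) v).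
Proof.
move=> gd gi; split.
  apply: continuous_comp; first exact: differentiable_continuous.
  exact: cinv_cont.
move=> xj; have xi := cinv_dom gi.
have := atlas_holo xi xj; rewrite cinvK// => td.
exact: (@differentiable_comp _ _ _ _ g (transition (chart_of i) (chart_of j))).
Qed.

(** The equation needs solving in one chart only: derivatives of curves and components of the field
    are transformed by the same transition Jacobian. *)
Lemma derive1_cinv (i j : atlas S) (g : C -> 'rV[C]_n) z :
  differentiable g z -> ccod (chart_of i) (g z) -> 'd g z 1 = ham_comp i (g z) ->
  cdom (chart_of j) (cinv (chart_of i) (g z)) ->
  derive1 (cmap (chart_of j) \o (cinv (chart_of i) \o g)) z =
    vf_comp (ham_vf S) j (cmap (chart_of j) (cinv (chart_of i) (g z))).
Proof.
move=> gd gi gE xj; have xi := cinv_dom gi.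
have td : differentiable (transition (chart_of i) (chart_of j)) (g z).
  by have := atlas_holo xi xj; rewrite cinvK.
rewrite -[LHS]/(derive1 (transition (chart_of i) (chart_of j) \o g) z).
apply: etrans (derive1E' (differentiable_comp gd td)) _.
apply: etrans (esym (diff_compE (1 : C) erefl gd td)) _.
have push q u : q = cmap (chart_of i) (cinv (chart_of i) (g z)) -> u = ham_comp i q ->
    'd (transition (chart_of i) (chart_of j)) q u =
    ham_comp j (cmap (chart_of j) (cinv (chart_of i) (g z))).
  move=> -> ->.
  exact: etrans (transition_diffE i j _ _) (esym (ham_comp_compat xi xj)).
exact: push (esym (cinvK gi)) gE.
Qed.

Lemma trajectory_chart (U : set C) (gamma : C -> S) z (i : atlas S) :
  trajectory U gamma -> U z -> cdom (chart_of i) (gamma z) ->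
  \forall w \near z, [/\ cdom (chart_of i) (gamma w),
    differentiable (cmap (chart_of i) \o gamma) w &
    'd (cmap (chart_of i) \o gamma) w 1 = ham_comp i ((cmap (chart_of i) \o gamma) w)].
Proof.
move=> [Uo _ Uh Ud] Uz iz.
have nU : \forall w \near z, U w by apply: open_nbhs_nbhs.
have ni : \forall w \near z, cdom (chart_of i) (gamma w).
  apply: (Uh z Uz).1; apply: open_nbhs_nbhs; split=> //; exact: cdom_open.
near=> w.
have Uw : U w by near: w.
have iw : cdom (chart_of i) (gamma w) by near: w.
have dw := (Uh w Uw).2 i iw.
by split => //; rewrite -(derive1E' dw) Ud.
Unshelve. all: by end_near. Qed.

Lemma trajectory_locally_unique (U1 U2 : set C) (gamma1 gamma2 : C -> S) z :
  trajectory U1 gamma1 -> trajectory U2 gamma2 -> U1 z -> U2 z ->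
  gamma1 z = gamma2 z -> \forall w \near z, gamma1 w = gamma2 w.
Proof.
move=> t1 t2 U1z U2z E.
have [i iz] := atlas_cover (gamma1 z).
have H1 := trajectory_chart t1 U1z iz.
have iz2 : cdom (chart_of i) (gamma2 z) by rewrite -E.
have H2 := trajectory_chart t2 U2z iz2.
have EE : \forall w \near z, cmap (chart_of i) (gamma1 w) = cmap (chart_of i) (gamma2 w).
  apply: (@ode_unique R _ (ham_comp (S:=S) i) (ccod (chart_of i))
    (cmap (chart_of i) (gamma1 z)) _ _ _ z (cmap (chart_of i) \o gamma1)
    (cmap (chart_of i) \o gamma2)) => //=.
  - exact: ccod_open.
  - exact: cmap_cod.
  - by move=> q; exact: ham_comp_differentiable.
  - by rewrite E.
  - by apply: filterS H1 => w [].
  - by apply: filterS H2 => w [].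
by apply: filterS3 H1 H2 EE => w [i1 _ _] [i2 _ _] e; rewrite -(cmapK i1) -(cmapK i2) e.
Qed.

Lemma trajectory_unique (U : set C) (gamma1 gamma2 : C -> S) z0 :
  trajectory U gamma1 -> trajectory U gamma2 -> U z0 -> gamma1 z0 = gamma2 z0 ->
  forall z, U z -> gamma1 z = gamma2 z.
Proof.
move=> t1 t2 Uz0 E.
have [Uo Uc h1 _] := t1; have [_ _ h2 _] := t2.
pose B := [set z | U z /\ gamma1 z = gamma2 z].
pose N := [set z | U z /\ gamma1 z <> gamma2 z].
have Bo : open B.
  rewrite openE => z [Uz Ez].
  have nU : \forall w \near z, U w by apply: open_nbhs_nbhs.
  have nE := trajectory_locally_unique t1 t2 Uz Uz Ez.
  by apply: filterS2 nU nE => w; split.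
(* Openness of [N] is the relative closedness of [B] in [U]; with local uniqueness, which makes [B]
   open, connectedness leaves only [B = U]. *)
have No : open N.
  rewrite openE => z [Uz Nz].
  have nU : \forall w \near z, U w by apply: open_nbhs_nbhs.
  have := carrier_hausdorff (c:=S); rewrite open_hausdorff => /(_ (gamma1 z) (gamma2 z)).
  case; first exact/eqP.
  move=> [P Q] /= [zP zQ] [Po Qo /disj_set2P PQ].
  rewrite inE in zP; rewrite inE in zQ.
  have nP : \forall w \near z, P (gamma1 w).
    by apply: (h1 z Uz).1; apply: open_nbhs_nbhs.
  have nQ : \forall w \near z, Q (gamma2 w).
    by apply: (h2 z Uz).1; apply: open_nbhs_nbhs.
  apply: filterS3 nU nP nQ => w Uw Pw Qw; split=> // Ew.
  have : (P `&` Q) (gamma1 w) by split => //; rewrite Ew.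
  by rewrite PQ.
suff BU : B = U by move=> z; rewrite -BU => -[].
apply: Uc.
- by exists z0.
- by exists B => //; apply/seteqP; split=> z; [move=> [? ?]; split; [|split]|move=> [_]].
exists (~` N); first exact: open_closedC.
apply/seteqP; split=> z.
  by move=> [Uz Ez]; split=> // -[].
move=> [Uz NN]; split => //; apply: contrapT => Ez; exact: NN.
Qed.

(** The equation is autonomous, so the trajectory starting at time [z1] is the chart flow run for
    the time [z - z1]. The disc [D] has radius [tau / 2] so that differences of its points stay
    below [tau]; it then serves both as common domain of the trajectories and as set of initial
    times. *)
Lemma trajectory_family (z0 : C) (x0 : S) :
  exists (D V : set C) (W : set S) (Gamma : C -> S -> C -> S),
    [/\ open V /\ V z0, open W /\ W x0, V `<=` D,
        (forall z1 x1, V z1 -> W x1 ->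
           trajectory D (Gamma z1 x1) /\ Gamma z1 x1 z1 = x1) &
        holomorphic_family D V W Gamma].
Proof.
have [i ix0] := atlas_cover x0.
pose ci := chart_of i; pose p := cmap ci x0.
have Fd q : ccod ci q -> differentiable (ham_comp (S:=S) i) q by exact: ham_comp_differentiable.
have [tau [sigma [phi [tau0 sigma0 phiP]]]] :=
  local_flow (@ccod_open _ _ _ ci) (cmap_cod ix0) Fd (@scomplete_mx R 1 n).
pose D : set C := [set z | rn (z - z0) < tau / 2].
pose W : set S := [set x | cdom ci x /\ rn (cmap ci x - p) < sigma].
have Do : open D.
  apply/rn_openP => z zD; exists (tau / 2 - rn (z - z0)); first by rewrite subr_gt0.
  by move=> w wz; rewrite /D /=; have := rn_tri z w z0; lra.
have Dz0 : D z0 by rewrite /D /= subrr rn0; lra.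
have Wo : open W.
  rewrite openE => x [xi xs].
  have n1 : \forall y \near x, cdom ci y.
    by apply: open_nbhs_nbhs; split=> //; exact: cdom_open.
  have n2 : \forall y \near x, rn (cmap ci y - p) < sigma.
    suff : \forall q \near cmap ci x, rn (q - p) < sigma by move/(cmap_cont xi).
    apply/rn_nearP; exists (sigma - rn (cmap ci x - p)); first by rewrite subr_gt0.
    by move=> q qx /=; have := rn_tri (cmap ci x) q p; lra.
  by apply: filterS2 n1 n2 => y; split.
have Wx0 : W x0 by split=> //; rewrite subrr rn0.
have DD z z1 : D z -> D z1 -> rn (z - z1) < tau.
  by move=> h h1; have := rn_tri z0 z z1; rewrite (rnC z0); move: h h1; rewrite /D /=; lra.
pose Gamma (z1 : C) (x1 : S) (z : C) : S := cinv ci (phi (z - z1) (cmap ci x1)).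
exists D, D, W, Gamma; split => //.
- move=> z1 x1 Dz1 [ix1 x1s].
  have at_z z : D z -> [/\ ccod ci (phi (z - z1) (cmap ci x1)),
      differentiable (fun w => phi (w - z1) (cmap ci x1)) z &
      'd (fun w => phi (w - z1) (cmap ci x1)) z 1 =
        ham_comp i (phi (z - z1) (cmap ci x1))].
    move=> Dz; have [pc _ pd pE] := phiP _ _ (DD z z1 Dz Dz1) x1s.
    have ld : is_diff z (fun w : C => (w - z1, cmap ci x1)) (fun v : C => (v - 0, 0)).
      exact: (is_diff_pair (is_diffB (is_diff_id z) (is_diff_cst z1 z))
        (is_diff_cst (cmap ci x1) z)).
    have [gd gE] := is_diff_compose ld (differentiableP pd).
    split=> //; apply: etrans (congr1 (fun h : C -> 'rV[C]_n => h 1) gE) _.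
    by rewrite /= subr0.
  split; last first.
    have [||_ pE _ _] := phiP 0 (cmap ci x1); [by rewrite rn0|by []|].
    by rewrite /Gamma subrr pE cmapK.
  split=> //.
  - exact: connected_rn_ball.
  - move=> z Dz; have [gi gd _] := at_z z Dz.
    split; first exact: (differentiable_cinv i gd gi).1.
    by move=> j xj; exact: (differentiable_cinv j gd gi).2.
  - by move=> z Dz j xj; have [gi gd gE] := at_z z Dz; exact: derive1_cinv gd gi gE xj.
move=> k [[z z1] q] /= [Dz Dz1 kq [iq qs]].
have [pc _ pd _] := phiP _ _ (DD z z1 Dz Dz1) qs.
(* The initial point may be read in any chart [k], while the flow lives in chart [i]: the family is
   the flow after subtracting times and changing charts. *)
pose h (w : C * C * 'rV[C]_n) : C * 'rV[C]_n :=
  (w.1.1 - w.1.2, transition (chart_of k) ci w.2).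
have fst_d (V1 V2 : normedModType C) (w : V1 * V2) : differentiable fst w.
  suff [] : is_diff w (fst : V1 * V2 -> V1) fst by [].
  apply: (@is_diff_bounded_linear _ _ _ _ _ 1) => // v.
  by rewrite mul1r rn_pair le_max lexx.
have snd_d (V1 V2 : normedModType C) (w : V1 * V2) : differentiable snd w.
  suff [] : is_diff w (snd : V1 * V2 -> V2) snd by [].
  apply: (@is_diff_bounded_linear _ _ _ _ _ 1) => // v.
  by rewrite mul1r rn_pair le_max lexx orbT.
have td : differentiable (transition (chart_of k) ci) q.
  by have := atlas_holo (cinv_dom kq) iq; rewrite cinvK.
have hd : differentiable h (z, z1, q).
  apply: differentiable_pair.
    apply: (@differentiableB _ _ _ (fst \o fst) (snd \o fst)).
      exact: differentiable_comp.
    exact: differentiable_comp.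
  exact: (@differentiable_comp _ _ _ _ snd (transition (chart_of k) ci)).
have gd : differentiable ((fun u : C * 'rV[C]_n => phi u.1 u.2) \o h) (z, z1, q).
  exact: differentiable_comp.
split; first exact: (differentiable_cinv i gd pc).1.
by move=> j xj; exact: (differentiable_cinv j gd pc).2.
Qed.

End Trajectories.

Theorem proposition2 (R : realType) (n : nat) (S : hol_ham_system (Cplx R) n) :
  (forall (z0 : Cplx R) (x0 : S),
     exists (U : set (Cplx R)) (gamma : Cplx R -> S),
       [/\ U z0, trajectory U gamma & gamma z0 = x0])
  /\
  (forall (z0 : Cplx R) (x0 : S)
          (U1 U2 : set (Cplx R)) (gamma1 gamma2 : Cplx R -> S),
     U1 z0 -> trajectory U1 gamma1 -> gamma1 z0 = x0 ->
     U2 z0 -> trajectory U2 gamma2 -> gamma2 z0 = x0 ->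
     (\forall z \near z0, gamma1 z = gamma2 z) /\
     (same_map U1 gamma1 U2 gamma2 <-> U1 = U2))
  /\
  (forall (z0 : Cplx R) (x0 : S),
     exists (D V : set (Cplx R)) (W : set S)
            (Gamma : Cplx R -> S -> Cplx R -> S),
       [/\ open V /\ V z0,
           open W /\ W x0,
           V `<=` D,
           (forall z1 x1, V z1 -> W x1 ->
              trajectory D (Gamma z1 x1) /\ Gamma z1 x1 z1 = x1) &
           holomorphic_family D V W Gamma]).
Proof.
split=> [z0 x0|]; last split=> [z0 x0 U1 U2 gamma1 gamma2 U1z t1 g1 U2z t2 g2|z0 x0].
- have [D [V [W [Gamma [[_ Vz] [_ Wx] VD tW _]]]]] := trajectory_family z0 x0.
  have [t E] := tW z0 x0 Vz Wx.
  by exists D, (Gamma z0 x0); split=> //; exact: VD.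
- have E : gamma1 z0 = gamma2 z0 by rewrite g1 g2.
  split; first exact: trajectory_locally_unique t1 t2 U1z U2z E.
  split=> [[]//|U12]; split=> //.
  by apply: trajectory_unique t1 _ U1z E; rewrite U12.
exact: trajectory_family.
Qed.
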